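(* Let $G$ be a group and let $K\unlhd G$ be a normal subgroup. 1. The canonical map $\mathcal B_K(G)\to\mathcal B(G/K)$ is a transfer homomorphism, and so $\mathcal L(\mathcal B_K(G))=\mathcal L(\mathcal B(G/K))$. Moreover: (i) $\mathcal U_k(\mathcal B_K(G))=\mathcal U_k(\mathcal B(G/K))$ is always an interval for every $k\in\mathbb N$. (ii) $\mathsf D_K(G)=\mathsf D(G/K)$; $\rho_k(\mathcal B_K(G))=\rho_k(\mathcal B(G/K))\le\frac{k\,\mathsf D(G/K)}{2}=\frac{k\,\mathsf D_K(G)}{2}$ for every $k\in\mathbb N$; and $\rho(\mathcal B_K(G))=\rho(\mathcal B(G/K))\le\frac{\mathsf D(G/K)}{2}=\frac{\mathsf D_K(G)}{2}$. In particular, if $G/K$ is finite, then $\rho(\mathcal B_K(G))=\frac{\mathsf D_K(G)}{2}$ is finite and accepted. 2. The class semigroup of $\mathcal B_K(G)$ in $\mathcal F(G)$ is isomorphic to the class semigroup of $\mathcal B(G/K)$ in $\mathcal F(G/K)$. 3. The following statements are equivalent: (a) $\mathcal B_K(G)$ is half-factorial. (b) $|G/K|\le 2$. (c) $\mathcal B(G/K)$ is factorial. (d) $\mathcal B(G/K)$ is half-factorial. 4. The following statements are equivalent: (a) $\mathcal B_K(G)$ is factorial. (b) $|G/K|\le 2$ and $|G\setminus K|\le 1$. (c) Either $K=G$, or else $G\cong C_2$ (a cyclic group of order 2) and $K=\{1_G\}$. In particular, if $K=\{1_G\}$, then 3.(b) is equivalent to 4.(b), and hence all statements in Items 3 and 4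 are equivalent. 5. We have $\mathsf c(\mathcal B_K(G),\phi_K)\le 2$, and if $|G/K|\ge 3$, then $\mathsf c(\mathcal B_K(G))=\mathsf c(\mathcal B(G/K))$.
   Context: Groups are written multiplicatively and need not be finite. $\mathbb N$ is the set of positive integers and $\mathbb N_0=\mathbb N\cup\{0\}$. Sequences: $\mathcal F(G)$ is the free abelian monoid with basis (the set) $G$; its elements $S=g_1\boldsymbol{\cdot}\ldots\boldsymbol{\cdot} g_\ell$ are called sequences over $G$, $\boldsymbol{\cdot}$ is concatenation, and $|S|=\ell$. The set of products is $\pi(S)=\{g_{\sigma(1)}\cdots g_{\sigma(\ell)}\in G : \sigma\text{ a permutation of }\{1,\dots,\ell\}\}$ (with $\pi=\{1_G\}$ for the empty sequence). For $K\unlhd G$, $\mathcal B_K(G)=\{S\in\mathcal F(G):\pi(S)\cap K\neq\emptyset\}$ is the monoid of product-$K$ sequences, and $\mathcal B(G)=\mathcal B_{\{1_G\}}(G)$ is the monoid of product-one sequences. $\mathsf D_K(G)=\sup\{|S| : S\text{ an atom of }\mathcal B_K(G)\}$ and $\mathsf D(G)=\mathsf D_{\{1_G\}}(G)$, in $\mathbb N\cup\{\infty\}$. $\phi_K:G\to G/K$ is the natural epimorphism, extended to sequences by $\phi_K(g_1\boldsymbol{\cdot}\ldots\boldsymbol{\cdot} g_\ell)=\phi_K(g_1)\boldsymbol{\cdot}\ldots\boldsymbol{\cdot}\phi_K(g_\ell)$. The canonical map $\mathcal B_K(G)\to\mathcal B(G/K)$ is the restriction of $\phi_K$, also denoted $\phi_K$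 in Item 5. Monoids: a monoid is a commutative cancellative semigroup with identity; $H^\times$ is the group of units of $H$. $H$ is atomic if every non-unit is a finite product of atoms (irreducible elements). A homomorphism $\theta:H\to D$ is a transfer homomorphism if (T1) $D=\theta(H)D^\times$ and $\theta^{-1}(D^\times)=H^\times$, and (T2) whenever $u\in H$, $b,c\in D$ and $\theta(u)=bc$, there are $v,w\in H$ with $u=vw$, $\theta(v)D^\times=bD^\times$, $\theta(w)D^\times=cD^\times$. Lengths: for an atomic monoid $H$ and a non-unit $a$, $\mathsf L(a)$ is the set of $k\in\mathbb N$ such that $a$ is a product of $k$ atoms; $\mathsf L(a)=\{0\}$ if $a$ is a unit. $\mathcal L(H)=\{\mathsf L(a):a\in H\}$. $H$ is factorial if every $a\in H$ has a unique factorization into atoms (up to order and associates), and half-factorial if $|\mathsf L(a)|=1$ for all $a\in H$. For $k\in\mathbb N$ and $H\ne H^\times$, $\mathcal U_k(H)=\bigcup_{L\in\mathcal L(H),\,k\in L}L$ and $\rho_k(H)=\sup\mathcal U_k(H)$. Write $\rho(L)=\sup L/\min L$, with $\rho(\{0\})=1$; the elasticity is $\rho(H)=\sup\{\rho(\mathsf L(a)):a\in H\}$, and it is accepted if $\rho(H)=\rho(\mathsf L(a))$ for some $a\in H$. An interval is a (finite or infinite) set of consecutive integers. Class semigroups: for monoids $H\subseteq F$ and $y,y'\in F$, put $y\sim_H y'$ iff for all $x\in F$: $yx\in H\Leftrightarrow y'x\in H$. Writing $[y]^F_H$ for the class of $y$, the class semigroup of $H$ in $F$ is $\mathcal C(H,F)=\{[y]^F_H:y\in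 F\}$ with operation $[x]^F_H+[y]^F_H=[xy]^F_H$. Catenary degrees: let $H$ be atomic, identifying associated atoms. A factorization of $a\in H$ is a formal (unordered) product of atoms with product $a$. Two factorizations can be written as $z=u_1\cdots u_\ell v_1\cdots v_m$ and $z'=u_1\cdots u_\ell w_1\cdots w_n$ with $\ell,m,n\in\mathbb N_0$, all $u_i,v_j,w_k$ atoms, and $\{v_1,\dots,v_m\}\cap\{w_1,\dots,w_n\}=\emptyset$; put $\mathsf d(z,z')=\max\{m,n\}$. $\mathsf c(a)$ is the smallest $N\in\mathbb N_0\cup\{\infty\}$ such that for any two factorizations $z,z'$ of $a$ there are factorizations $z=z_0,z_1,\dots,z_k=z'$ of $a$ with $\mathsf d(z_{i-1},z_i)\le N$ for all $i\in\{1,\dots,k\}$; $\mathsf c(H)=\sup\{\mathsf c(a):a\in H\}$. For a transfer homomorphism $\theta:H\to D$ of atomic monoids (which maps atoms to atoms) and a factorization $z=u_1\cdots u_\ell$ of $a$, let $\overline\theta(z)=\theta(u_1)\cdots\theta(u_\ell)$, a factorization of $\theta(a)$ in $D$. $\mathsf c(a,\theta)$ is the smallest $N\in\mathbb N_0\cup\{\infty\}$ such that for any two factorizations $z,z'$ of $a$ with $\overline\theta(z)=\overline\theta(z')$ there are $k\in\mathbb N_0$ and factorizations $z=z_0,z_1,\dots,z_k=z'$ of $a$ with $\overline\theta(z_i)=\overline\theta(z)$ and $\mathsf d(z_{i-1},z_i)\le N$ for all $i\in\{1,\dots,k\}$; $\mathsf c(H,\theta)=\sup\{\mathsf c(a,\theta):a\in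 H\}$.
   Formalization: In Item 1(ii) the bounds on ρ_k and ρ by kD/2 and D/2, and the equality ρ = D_K(G)/2 for finite G/K, are stated only for K ≠ G; for K = G they fail, since then D_K(G) = 1, ρ_k = k and ρ = 1. *)

(* Defs.v *)
From HB Require Import structures.
From mathcomp Require Import all_boot all_order all_algebra finmap multiset.
From mathcomp Require Import boolp classical_sets functions cardinality.
From mathcomp Require Import generic_quotient reals ereal.

Set Implicit Arguments.
Unset Strict Implicit.
Unset Printing Implicit Defensive.

Local Open Scope quotient_scope.
Local Open Scope mset_scope.
Local Open Scope classical_set_scope.
Local Open Scope group_scope.

HB.mixin Record Monoid_isCommCancel H of Monoid H := {
  ccmulC : commutative ( *%g : H -> H -> H);
  ccmulI : right_injective ( *%g : H -> H -> H)
}.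

#[short(type="ccMonoidType")]
HB.structure Definition CCMonoid := {H of Monoid_isCommCancel H & Monoid H}.

Section MonoidNotions.
Variable H : ccMonoidType.
Implicit Types (a b c u v : H) (s : seq H).

Definition munits : set H := [set u | exists v, u * v = 1].

Definition atom a : Prop :=
  ~ munits a /\ forall b c, a = b * c -> munits b \/ munits c.

Definition associated a b : Prop := exists2 u, munits u & b = a * u.

Lemma munits1 : munits 1.
Proof. by exists 1; rewrite mulg1. Qed.

Lemma munitsM u v : munits u -> munits v -> munits (u * v).
Proof.
move=> [u' uu'] [v' vv']; exists (v' * u').
by rewrite mulgA -(mulgA u) vv' mulg1.
Qed.

Lemma associated_refl : reflexive (fun a b => `[< associated a b >]).
Proof. by move=> a; apply/asboolP; exists 1; [exact: munits1 | rewrite mulg1]. Qed.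

Lemma associated_sym : symmetric (fun a b => `[< associated a b >]).
Proof.
suff sub a b : associated a b -> associated b a.
  by move=> a b; apply/asboolP/asboolP; exact: sub.
move=> [u [v uv] ->]; exists v; last by rewrite -mulgA uv mulg1.
by exists u; rewrite ccmulC.
Qed.

Lemma associated_trans : transitive (fun a b => `[< associated a b >]).
Proof.
move=> b a c /asboolP[u Uu ->] /asboolP[v Uv ->]; apply/asboolP.
by exists (u * v); [exact: munitsM | rewrite mulgA].
Qed.

Canonical associated_equiv :=
  EquivRel (fun a b => `[< associated a b >])
    associated_refl associated_sym associated_trans.

Definition assocClass := {eq_quot associated_equiv}.
HB.instance Definition _ := Choice.on assocClass.
HB.instance Definition _ := EqQuotient.on assocClass.

Definition lengths a : set nat :=
  [set k | (munits a /\ k = 0%N) \/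
    [/\ ~ munits a, (0 < k)%N &
        exists s, [/\ size s = k, (forall u, u \in s -> atom u)
                    & a = \prod_(u <- s) u]]].

Definition system_of_lengths : set (set nat) := range lengths.

Definition half_factorial : Prop := forall a, exists k, lengths a = [set k].

Definition Uset (k : nat) : set nat :=
  \bigcup_(L in [set L | system_of_lengths L /\ L k]) L.

(* Associated atoms are identified: a factorization is a formal product
   (a multiset) of classes of atoms. *)
Definition factorizations a : set {mset assocClass} :=
  [set z : {mset assocClass} |
     (forall c : assocClass, c \in z -> atom (repr c)) /\
     associated (\prod_(c <- z) repr c) a].

Definition factorial_monoid : Prop := forall a, exists! z, factorizations a z.

End MonoidNotions.

Definition nat_interval (A : set nat) : Prop :=
  forall m n p, A m -> A p -> (m <= n <= p)%N -> A n.

(* Removing the common part of z and z' leaves z `\` z' and z' `\` z. *)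
Definition fact_dist (T : choiceType) (z z' : {mset T}) : nat :=
  maxn (size (z `\` z')%mset) (size (z' `\` z)%mset).

Definition chained (T : choiceType) (Z : set {mset T}) (N : nat)
    (z z' : {mset T}) : Prop :=
  exists s : seq {mset T},
    [/\ (forall y, y \in s -> Z y),
        path (fun x y => (fact_dist x y <= N)%N) z s
      & last z s = z'].

Definition transfer_hom (H D : ccMonoidType) (theta : H -> D) : Prop :=
  [/\ monoid_morphism theta,
      (forall d, exists h, exists2 u, munits u & d = theta h * u),
      theta @^-1` (@munits D) = @munits H
    & forall u b c, theta u = b * c ->
        exists v w, [/\ u = v * w, associated (theta v) b
                      & associated (theta w) c]].

Definition map_mset (T U : choiceType) (f : T -> U) (S : {mset T}) : {mset U} :=
  seq_mset (map f S).

Definition fact_image (H D : ccMonoidType) (theta : H -> D)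
    (z : {mset assocClass H}) : {mset assocClass D} :=
  map_mset (fun c : assocClass H => \pi_(assocClass D) (theta (repr c))) z.

Section Invariants.
Variable R : realType.
Local Open Scope ereal_scope.

(* For nonempty A these are the supremum in N \cup {oo} and the minimum of A;
   ninf set0 = +oo is the value of a catenary degree that no N bounds. *)
Definition nsup (A : set nat) : \bar R := ereal_sup [set n%:R%:E | n in A].
Definition ninf (A : set nat) : \bar R := ereal_inf [set n%:R%:E | n in A].

Definition rho_k (H : ccMonoidType) (k : nat) : \bar R := nsup (@Uset H k).

Definition rho_set (L : set nat) : \bar R :=
  if `[< L = [set 0%N] >] then 1 else nsup L / ninf L.

Definition elasticity (H : ccMonoidType) : \bar R :=
  ereal_sup [set rho_set (lengths a) | a in [set: H]].

Definition accepted_elasticity (H : ccMonoidType) : Prop :=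
  exists a : H, elasticity H = rho_set (lengths a).

Definition cat_deg_elt (H : ccMonoidType) (a : H) : \bar R :=
  ninf [set N | forall z z', factorizations a z -> factorizations a z' ->
                  chained (factorizations a) N z z'].

Definition cat_deg (H : ccMonoidType) : \bar R :=
  ereal_sup [set cat_deg_elt a | a in [set: H]].

Definition cat_deg_fib_elt (H D : ccMonoidType) (theta : H -> D) (a : H) :
    \bar R :=
  ninf [set N | forall z z', factorizations a z -> factorizations a z' ->
    fact_image theta z = fact_image theta z' ->
    chained (factorizations a `&`
             [set y | fact_image theta y = fact_image theta z]) N z z'].

Definition cat_deg_fib (H D : ccMonoidType) (theta : H -> D) : \bar R :=
  ereal_sup [set cat_deg_fib_elt theta a | a in [set: H]].

End Invariants.

Section ClassSemigroup.
Variables (F : ccMonoidType) (H : umagmaClosed F).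
Implicit Types x y : F.

Definition class_rel : rel F :=
  fun y y' => `[< forall x, (y * x \in H) <-> (y' * x \in H) >].

Lemma class_rel_refl : reflexive class_rel.
Proof. by move=> y; apply/asboolP. Qed.

Lemma class_rel_sym : symmetric class_rel.
Proof. by move=> y y'; apply/asboolP/asboolP => e x; split=> /e. Qed.

Lemma class_rel_trans : transitive class_rel.
Proof.
move=> y2 y1 y3 /asboolP e12 /asboolP e23; apply/asboolP => x.
by split=> [/e12/e23|/e23/e12].
Qed.

Canonical class_equiv :=
  EquivRel class_rel class_rel_refl class_rel_sym class_rel_trans.

Definition classSemigroup := {eq_quot class_equiv}.
HB.instance Definition _ := Choice.on classSemigroup.
HB.instance Definition _ := EqQuotient.on classSemigroup.

(* The operation is written multiplicatively. *)
Definition class_mul (c d : classSemigroup) : classSemigroup :=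
  \pi_classSemigroup (repr c * repr d).

Lemma class_relM x x' y y' :
  class_rel x x' -> class_rel y y' -> class_rel (x * y) (x' * y').
Proof.
move=> /asboolP ex /asboolP ey; apply/asboolP => z.
rewrite -!mulgA; apply: (iff_trans (ex _)).
by rewrite !(mulgA x') !(ccmulC x') -!mulgA; exact: ey.
Qed.

Lemma class_mulE x y :
  class_mul (\pi x) (\pi y) = (\pi_classSemigroup (x * y)).
Proof.
apply/eqP; rewrite /class_mul eqmodE; apply: class_relM.
all: by rewrite -[class_rel _ _]eqmodE reprK.
Qed.

Lemma class_mulA : associative class_mul.
Proof.
move=> c d e; rewrite -[c]reprK -[d]reprK -[e]reprK.
by rewrite !class_mulE mulgA.
Qed.

HB.instance Definition _ := isSemigroup.Build classSemigroup class_mulA.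

End ClassSemigroup.

Definition isomorphic (X Y : magmaType) : Prop :=
  exists f : {multiplicative X -> Y}, bijective f.

(* Subsets of G are boolean predicates; with boolp, [pred x | `[< P x >]] turns
   any Prop-valued normal subgroup into one of this kind. *)
HB.mixin Record isConjClosed (G : groupType) (K : {pred G}) := {
  gpredJ : forall x y, x \in K -> x ^ y \in K
}.

#[short(type="normalClosed")]
HB.structure Definition NormalClosed (G : groupType) :=
  {K of isConjClosed G K & GroupClosed G K}.

Section QuotientGroup.
Variables (G : groupType) (K : normalClosed G).
Implicit Types x y z : G.

Definition coset_rel : rel G := fun x y => x^-1 * y \in K.

Lemma coset_rel_refl : reflexive coset_rel.
Proof. by move=> x; rewrite /coset_rel mulVg gpred1. Qed.

Lemma coset_rel_sym : symmetric coset_rel.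
Proof. by move=> x y; rewrite /coset_rel -gpredV invgM invgK. Qed.

Lemma coset_rel_trans : transitive coset_rel.
Proof.
move=> y x z Kxy Kyz; rewrite /coset_rel.
by rewrite -(mulVKg y z) mulgA gpredM.
Qed.

Canonical coset_equiv :=
  EquivRel coset_rel coset_rel_refl coset_rel_sym coset_rel_trans.

Definition quotGroup := {eq_quot coset_equiv}.
HB.instance Definition _ := Choice.on quotGroup.
HB.instance Definition _ := EqQuotient.on quotGroup.

Definition phi x : quotGroup := (\pi_quotGroup x).

Definition quot_one := phi 1.
Definition quot_mul (c d : quotGroup) := phi (repr c * repr d).
Definition quot_inv (c : quotGroup) := phi (repr c)^-1.

Lemma phiP x y : reflect (phi x = phi y) (x^-1 * y \in K).
Proof. by apply: (iffP idP) => [xy|/eqP]; [apply/eqP|]; rewrite eqmodE. Qed.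

Lemma phi_repr (c : quotGroup) : phi (repr c) = c.
Proof. exact: reprK. Qed.

Lemma coset_reprP x : (repr (phi x))^-1 * x \in K.
Proof. by apply/phiP; rewrite phi_repr. Qed.

Lemma quot_mulE x y : quot_mul (phi x) (phi y) = phi (x * y).
Proof.
apply/phiP; have := coset_reprP x; have := coset_reprP y.
move: (repr (phi x)) (repr (phi y)) => x' y' Ky Kx.
have -> : (x' * y')^-1 * (x * y) = (x'^-1 * x) ^ y' * (y'^-1 * y).
  by rewrite invgM conjgE !mulgA mulgK.
by rewrite gpredM ?gpredJ.
Qed.

Lemma quot_invE x : quot_inv (phi x) = phi x^-1.
Proof.
apply/phiP; have := coset_reprP x; move: (repr (phi x)) => x' Kx.
have -> : x'^-1^-1 * x^-1 = ((x'^-1 * x)^-1) ^ (x'^-1).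
  by rewrite invgM conjgE !invgK !mulgA mulgK.
by rewrite gpredJ ?gpredV.
Qed.

Lemma quot_mulA : associative quot_mul.
Proof.
move=> c d e; rewrite -[c]phi_repr -[d]phi_repr -[e]phi_repr.
by rewrite !quot_mulE mulgA.
Qed.

Lemma quot_mul1 : left_id quot_one quot_mul.
Proof. by move=> c; rewrite -[c]phi_repr quot_mulE mul1g. Qed.

Lemma quot_mulr1 : right_id quot_one quot_mul.
Proof. by move=> c; rewrite -[c]phi_repr quot_mulE mulg1. Qed.

Lemma quot_mulV : left_inverse quot_one quot_inv quot_mul.
Proof. by move=> c; rewrite -[c]phi_repr quot_invE quot_mulE mulVg. Qed.

Lemma quot_mulrV : right_inverse quot_one quot_inv quot_mul.
Proof. by move=> c; rewrite -[c]phi_repr quot_invE quot_mulE mulgV. Qed.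

HB.instance Definition _ :=
  isGroup.Build quotGroup quot_mulA quot_mul1 quot_mulr1 quot_mulV quot_mulrV.

Lemma phi_morph : monoid_morphism phi.
Proof. by split=> [|x y]; [|rewrite -quot_mulE]. Qed.

HB.instance Definition _ :=
  isUMagmaMorphism.Build G quotGroup phi phi_morph.

End QuotientGroup.

Section TrivialSubgroup.
Variable G : groupType.

Definition triv_subgroup : {pred G} := pred1 1.

Lemma triv_group_closed : group_closed triv_subgroup.
Proof.
by split=> [|x y]; rewrite !inE // => /eqP-> /eqP->; rewrite divg1.
Qed.

Lemma triv_conj_closed x y : x \in triv_subgroup -> x ^ y \in triv_subgroup.
Proof. by rewrite !inE => /eqP->; rewrite conj1g. Qed.

HB.instance Definition _ := isMulClosed.Build G triv_subgroup
  (group_closedM triv_group_closed).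
HB.instance Definition _ := isMul1Closed.Build G triv_subgroup
  (fst triv_group_closed).
HB.instance Definition _ := isInvClosed.Build G triv_subgroup
  (group_closedV triv_group_closed).
HB.instance Definition _ := isConjClosed.Build G triv_subgroup
  triv_conj_closed.

End TrivialSubgroup.
Arguments triv_subgroup G : clear implicits.

Definition triv_normal (G : groupType) : normalClosed G := triv_subgroup G.

Section FreeAbelianMonoid.
Variable T : choiceType.
Implicit Types A B C : {mset T}.

Let mset0D : left_id (@mset0 T) (@msetD T). Proof. exact: mset0D. Qed.
Let msetD0 : right_id (@mset0 T) (@msetD T). Proof. exact: msetD0. Qed.
Let msetDA : associative (@msetD T). Proof. exact: msetDA. Qed.

HB.instance Definition _ := Choice.copy {mset T} {fsfun T -> nat with 0%N}.
HB.instance Definition _ :=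
  isMonoid.Build {mset T} msetDA mset0D msetD0.

Let msetDC : commutative ( *%g : {mset T} -> {mset T} -> {mset T}). Proof. exact: msetDC. Qed.
Let msetDI : right_injective ( *%g : {mset T} -> {mset T} -> {mset T}).
Proof.
move=> A B C /msetP e; apply/msetP => x.
by have := e x; rewrite !msetE2 => /addnI.
Qed.

HB.instance Definition _ := Monoid_isCommCancel.Build {mset T} msetDC msetDI.

End FreeAbelianMonoid.

Section ProductSequences.
Variable G : groupType.
Implicit Types S T : {mset G}.

(* The set pi(S); permutations [::] = [:: [::]], so the empty sequence yields
   only the product 1. *)
Definition products S : seq G :=
  [seq \prod_(g <- s) g | s <- permutations S].

Variable K : normalClosed G.

Definition product_in : {pred {mset G}} :=
  [pred S : {mset G} | has [in K] (products S)].

Lemma product_inP S :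
  reflect (exists2 s : seq G, seq_mset s = S & \prod_(g <- s) g \in K)
          (S \in product_in).
Proof.
apply: (iffP hasP) => [[g /mapP[s ps ->] Kg]|[s sS Ks]].
  exists s => //; rewrite -[RHS]seq_mset_id; apply/eq_seq_msetP.
  by rewrite -mem_permutations.
exists (\prod_(g <- s) g) => //; apply/mapP; exists s => //.
by rewrite mem_permutations; apply/eq_seq_msetP; rewrite sS seq_mset_id.
Qed.

Lemma product_in1 : 1 \in product_in.
Proof.
apply/product_inP; exists [::]; last by rewrite big_nil gpred1.
by apply/msetP => x; rewrite mset_seqE mset0E.
Qed.

Lemma product_inM : mulg_closed product_in.
Proof.
move=> S T /product_inP[s <- Ks] /product_inP[t <- Kt].
apply/product_inP; exists (s ++ t); last by rewrite big_cat gpredM.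
by apply/msetP => x; rewrite msetE2 !mset_seqE count_cat.
Qed.

Lemma product_in_closed : monoid_closed product_in.
Proof. by split; [exact: product_in1 | exact: product_inM]. Qed.

HB.instance Definition _ := isMulClosed.Build {mset G} product_in product_inM.
HB.instance Definition _ := isMul1Closed.Build {mset G} product_in product_in1.

Record prodMonoid := ProdSeq {
  seq_of : {mset G};
  seq_ofP : seq_of \in product_in
}.

HB.instance Definition _ := [isSub for seq_of].
HB.instance Definition _ := [Choice of prodMonoid by <:].
HB.instance Definition _ := SubChoice_isSubMonoid.Build {mset G}
  product_in prodMonoid product_in_closed.

Let prodMonoidC : commutative ( *%g : prodMonoid -> prodMonoid -> prodMonoid).
Proof. by move=> x y; apply: val_inj; rewrite !valM ccmulC. Qed.
Let prodMonoidI : right_injective ( *%g : prodMonoid -> prodMonoid -> prodMonoid).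
Proof.
move=> x y z /(congr1 val); rewrite !valM => /ccmulI e.
exact: val_inj.
Qed.

HB.instance Definition _ :=
  Monoid_isCommCancel.Build prodMonoid prodMonoidC prodMonoidI.

End ProductSequences.

Definition prodOneMonoid (G : groupType) : ccMonoidType :=
  prodMonoid (triv_normal G).

Section CanonicalMap.
Variables (G : groupType) (K : normalClosed G).

Lemma map_phi_product_in (S : {mset G}) : S \in product_in K ->
  map_mset (phi K) S \in product_in (triv_normal (quotGroup K)).
Proof.
move=> /product_inP[s <- Ks]; apply/product_inP; exists (map (phi K) s).
  by apply/eq_seq_msetP/perm_map; rewrite perm_sym perm_eq_seq_mset.
rewrite big_map -(big_morph (phi K) (snd (phi_morph K)) (fst (phi_morph K))).
rewrite inE -(fst (phi_morph K)); apply/eqP/esym/phiP.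
by rewrite invg1 mul1g.
Qed.

Definition phi_seq (S : prodMonoid K) : prodOneMonoid (quotGroup K) :=
  ProdSeq (map_phi_product_in (seq_ofP S)).

End CanonicalMap.

Definition davenport (R : realType) (G : groupType) (K : normalClosed G) :
    \bar R :=
  nsup R [set size (seq_of S) | S in @atom (prodMonoid K)].

(* Main.v *)
From HB Require Import structures.
Require Import Defs.
From mathcomp Require Import all_boot all_order all_algebra finmap multiset.
From mathcomp Require Import boolp classical_sets functions cardinality.
From mathcomp Require Import generic_quotient reals ereal.
From mathcomp Require Import zify.
Import Order.TTheory GRing.Theory Num.Theory.

Set Implicit Arguments.
Unset Strict Implicit.
Unset Printing Implicit Defensive.

(** Whether a sequence over [G] has a product in [K] can be read off from its
image over [G/K] ([product_in_phi]): an ordering of the image with product one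
lifts to an ordering with product in [K].  Hence a factorization of the image
lifts letter by letter, so [phi_seq] is a transfer homomorphism
([phi_seq_transfer]), and the class relations upstairs and downstairs coincide
([class_rel_phi]), which identifies the class semigroups.  Both monoids are reduced, and a transfer
homomorphism of reduced monoids lifts factorizations ([factors_lift]); this
gives equal systems of lengths, and in addition sizes of atoms are preserved,
so the two Davenport constants agree.  Everything else about lengths is proved
for an arbitrary pair [(G, K)], hence also for [(G/K, 1)].

- Intervals ([Uset_interval]).  Let [U_1 ... U_k = V_1 ... V_l] with [k < l].
  Some [U_i], written as a word with product in [K], has two adjacent letters
  [x, y] lying in different [V_j] ([split_adjacent]): otherwise every [U_i] sits
  inside a single [V_j], and [l <= k].  Replacing [x, y] by the one letter
  [x * y] keeps [U_i] an atom and fuses the two [V_j] into one product-[K]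
  sequence, so the number of factors on the right drops by at most one while
  the total length drops; induction on the total length reaches every value
  between [k] and [l].

- Elasticity.  Count the letters of a sequence, those in [K] twice.  This weight
  is additive, every atom has weight at least [2], and at most the Davenport
  constant [D] once [D >= 2]; so [2 l <= k D] ([lengths_ratio]).  If [G/K] is
  finite, then [D] is finite ([atom_size_le]) and is the size of some atom [U];
  the product of [U] and its inverse sequence [U^-1] is also the product of the
  [D] atoms [g . g^-1], so it has the lengths [2] and [D].

- Small index.  If [|G/K| >= 3] there are [x, y] with [x, y, x * y] outside [K];
  then [U = x . y . (x * y)^-1] is an atom and [U . U^-1] has the lengths [2] and
  [3].  If at most one element lies outside [K], an atom is determined by any one
  of its letters, so multiplicities of letters determine factorizations.  Two
  distinct elements [x, y] outside [K] would give, in index two,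
  [(x . x) (y . y) = (x . y) (x . y)].

- Catenary degrees.  For a transfer homomorphism [theta], chains downstairs lift
  step by step up to a last correction inside a fibre ([connected_lift]), so the
  two catenary degrees agree when the fibres are connected by steps of size [2]
  and the degree downstairs is at least [2].  In a fibre, exchanging a letter of
  one atom with a letter of another one in the same coset of [K] changes two
  atoms only and does not change the image; such exchanges turn any
  factorization into any other one of the same fibre ([fibre_connected2]). *)

(** * Multisets, chains of multisets and reduced monoids *)

(** Products over lists become invariant under permutation ([perm_big]). *)
HB.instance Definition _ (H : ccMonoidType) :=
  SemiGroup.isCommutativeLaw.Build H *%g (@ccmulC H).

Section LinkedSequences.
Variable T : choiceType.
Implicit Types (s t w p q : seq T) (A B : {mset T}%mset) (N : nat).
Local Open Scope mset_scope.

Lemma size_seq_mset s : size (seq_mset s : seq T) = size s.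
Proof. exact/perm_size/perm_eq_seq_mset. Qed.

Lemma seq_mset_cat s t : seq_mset (s ++ t) = seq_mset s `+` seq_mset t.
Proof. by apply/msetP=> x; rewrite msetE2 !mset_seqE count_cat. Qed.

Lemma perm_msetD A B : perm_eq (A `+` B) (A ++ B).
Proof. by apply/eq_seq_msetP; rewrite seq_mset_cat !seq_mset_id. Qed.

Lemma size_msetD A B : size (A `+` B) = (size A + size B)%N.
Proof. by rewrite (perm_size (perm_msetD A B)) size_cat. Qed.

Lemma size_msubset A B : A `<=` B -> size A <= size B.
Proof. by move=> /msetBDKC <-; rewrite size_msetD leq_addr. Qed.

Lemma size_msetB_le A B : size (A `\` B) <= size A.
Proof. exact/size_msubset/msubsetDl. Qed.

(** The condition [fact_dist <= N] for lists standing for multisets; the common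
part [w] need not be the full intersection, which makes it easy to verify. *)
Definition linked N s t := exists w p q,
  [/\ perm_eq s (w ++ p), perm_eq t (w ++ q), size p <= N & size q <= N].

Lemma fact_dist_seq_mset N s t :
  fact_dist (seq_mset s) (seq_mset t) <= N <-> linked N s t.
Proof.
split=> [|[w [p [q [es et ps qs]]]]]; last first.
  move/eq_seq_msetP: es => ->; move/eq_seq_msetP: et => ->.
  rewrite /fact_dist !seq_mset_cat !msetBDl geq_max.
  by rewrite !(leq_trans (size_msetB_le _ _)) ?size_seq_mset.
rewrite /fact_dist geq_max => /andP[ps qs].
exists (seq_mset s `&` seq_mset t), (seq_mset s `\` seq_mset t).
exists (seq_mset t `\` seq_mset s).
split=> //; apply/eq_seq_msetP/msetP => x; rewrite !mset_seqE count_cat.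
  by rewrite !count_mem_mset !msetE2 !mset_seqE; lia.
by rewrite !count_mem_mset !msetE2 !mset_seqE; lia.
Qed.

End LinkedSequences.

Lemma map_mset_seq (T U : choiceType) (f : T -> U) s :
  map_mset f (seq_mset s) = seq_mset (map f s).
Proof. exact/eq_seq_msetP/perm_map/perm_eq_seq_mset. Qed.

Lemma map_msetD (T U : choiceType) (f : T -> U) (A B : {mset T}%mset) :
  map_mset f (A `+` B)%mset = (map_mset f A `+` map_mset f B)%mset.
Proof.
rewrite -{1}[A]seq_mset_id -{1}[B]seq_mset_id -seq_mset_cat map_mset_seq map_cat.
by rewrite seq_mset_cat.
Qed.

Lemma map_mset0 (T U : choiceType) (f : T -> U) : map_mset f mset0 = mset0.
Proof. by apply/msetP=> x; rewrite /map_mset enum_mset0 mset_seqE mset0E. Qed.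

Lemma linked_map (T U : choiceType) (f : T -> U) N s t :
  linked N s t -> linked N (map f s) (map f t).
Proof.
move=> [w [p [q [es et ps qs]]]]; exists (map f w), (map f p), (map f q).
by rewrite !size_map -!map_cat; split=> //; exact: perm_map.
Qed.

(** Rearranging an image lifts to a rearrangement of the source.  This is how
orderings and factorizations are pulled back along a map. *)
Lemma perm_map_lift (T U : eqType) (f : T -> U) s t :
  perm_eq (map f s) t -> exists2 s', perm_eq s s' & map f s' = t.
Proof.
elim: t s => [|y t IH] s e.
  by exists [::] => //; move/perm_nilP: e; case: s.
have: y \in map f s by rewrite (perm_mem e) mem_head.
case/mapP => x xs yE; have e' := perm_to_rem xs.
have: perm_eq (map f (rem x s)) t.
  by rewrite -(perm_cons y) -(permPr e) yE -map_cons perm_sym perm_map.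
case/IH => s' es' <-; exists (x :: s') => /=; last by rewrite yE.
by rewrite (permPl e') perm_cons.
Qed.

Section Chains.
Variable T : choiceType.
Implicit Types (Z : set {mset T}%mset) (N : nat) (x y z : {mset T}%mset).

Lemma chained_refl Z N z : chained Z N z z.
Proof. by exists [::]. Qed.

Lemma chained_step Z N x y z :
  Z y -> fact_dist x y <= N -> chained Z N y z -> chained Z N x z.
Proof.
move=> Zy xy [s [Zs ps ls]]; exists (y :: s); split=> //=.
  by move=> w; rewrite inE => /predU1P[->|/Zs].
by rewrite xy.
Qed.

Lemma chained_trans Z N x y z :
  chained Z N x y -> chained Z N y z -> chained Z N x z.
Proof.
move=> [s [Zs ps ls]] [t [Zt pt lt]]; exists (s ++ t); split.
- by move=> w; rewrite mem_cat => /orP[/Zs|/Zt].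
- by rewrite cat_path ps ls.
- by rewrite last_cat ls.
Qed.

(** A chain is used as a reflexive transitive closure, read from its start. *)
Lemma chained_ind Z N (P : {mset T}%mset -> {mset T}%mset -> Prop) :
  (forall z, P z z) ->
  (forall x y z, Z y -> fact_dist x y <= N -> chained Z N y z -> P y z -> P x z) ->
  forall x z, chained Z N x z -> P x z.
Proof.
move=> P0 PS x z [s [Zs ps <-]] {z}.
elim: s x Zs ps => [|y s IH] x Zs /=; first by move=> _; exact: P0.
case/andP=> xy ps; have Zs' w : w \in s -> Z w.
  by move=> ws; apply: Zs; rewrite inE ws orbT.
apply: (PS _ y) => //; first by apply: Zs; rewrite mem_head.
  by exists s.
exact: IH.
Qed.

Lemma chained_mono Z Z' N N' x z : N <= N' -> (Z `<=` Z')%classic ->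
  chained Z N x z -> chained Z' N' x z.
Proof.
move=> NN' ZZ'; move: x z; apply: chained_ind => [z|x y z Zy xy _ IH].
  exact: chained_refl.
by apply: chained_step IH; [exact: ZZ' | exact: leq_trans NN'].
Qed.

End Chains.

Section ReducedMonoids.
Variable H : ccMonoidType.
Implicit Types (a b u v : H) (s t : seq H).
Local Open Scope group_scope.

(** A constant rather than a bare iterated product: over a concrete monoid the
unit and the multiplication can be found along several paths of the hierarchy,
and equal products would then fail to match syntactically. *)
Definition mprod s : H := \prod_(u <- s) u.

Lemma mprod_nil : mprod [::] = 1.
Proof. exact: big_nil. Qed.

Lemma mprod_cons u s : mprod (u :: s) = u * mprod s.
Proof. exact: big_cons. Qed.

Lemma mprod_seq1 u : mprod [:: u] = u.
Proof. exact: big_seq1. Qed.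

Lemma mprod_cat s t : mprod (s ++ t) = mprod s * mprod t.
Proof. exact: big_cat. Qed.

Definition reduced := forall u : H, munits u -> u = 1.

Definition factors a s := (forall u, u \in s -> atom u) /\ mprod s = a.

Lemma perm_prod s t : perm_eq s t -> mprod s = mprod t.
Proof. exact: perm_big. Qed.

Lemma factors_perm a s t : perm_eq s t -> factors a s -> factors a t.
Proof.
move=> e [As <-]; split; last by rewrite (perm_prod e).
by move=> u; rewrite -(perm_mem e) => /As.
Qed.

Lemma factors1 u : atom u -> factors u [:: u].
Proof. by move=> Au; split=> [v|]; [rewrite inE => /eqP-> | rewrite mprod_seq1]. Qed.

Lemma factors_cat a b s t : factors a s -> factors b t -> factors (a * b) (s ++ t).
Proof.
move=> [As <-] [At <-]; split; last by rewrite mprod_cat.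
by move=> u; rewrite mem_cat => /orP[/As|/At].
Qed.

Lemma factors_catE a s t : factors a (s ++ t) ->
  exists b c, [/\ a = b * c, factors b s & factors c t].
Proof.
move=> [Ast <-]; exists (mprod s), (mprod t).
split; first by rewrite mprod_cat.
  by split=> // u us; apply: Ast; rewrite mem_cat us.
by split=> // u us; apply: Ast; rewrite mem_cat us orbT.
Qed.

Lemma munitsMl u v : munits (u * v) -> munits u.
Proof. by case=> w uvw; exists (v * w); rewrite mulgA. Qed.

Lemma atom_neq1 u : atom u -> u <> 1.
Proof. by move=> [nU _] u1; apply: nU; rewrite u1; exact: munits1. Qed.

(** Over a reduced monoid, passing to classes of associated elements loses
nothing, and factorizations can be given by lists of representatives. *)
Definition formal s : {mset assocClass H}%mset :=
  seq_mset [seq (\pi_(assocClass H) u)%qT | u <- s].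

Hypothesis redH : reduced.

Lemma associated_eq a b : associated a b <-> a = b.
Proof.
split=> [[u /redH-> ->]|->]; first by rewrite mulg1.
by exists 1; [exact: munits1 | rewrite mulg1].
Qed.

Lemma repr_class u : repr (\pi_(assocClass H) u)%qT = u.
Proof.
apply/associated_eq/asboolP.
have /eqP : (\pi_(assocClass H) (repr (\pi_(assocClass H) u)) = \pi_(assocClass H) u)%qT.
  by rewrite reprK.
by rewrite eqmodE.
Qed.

Lemma map_repr_class s : map repr [seq (\pi_(assocClass H) u)%qT | u <- s] = s.
Proof. by rewrite -map_comp map_id_in // => u _ /=; rewrite repr_class. Qed.

Lemma formal_eqP s t : reflect (formal s = formal t) (perm_eq s t).
Proof.
apply: (iffP idP) => [e|]; first exact/eq_seq_msetP/perm_map.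
by move/eq_seq_msetP/(perm_map repr); rewrite !map_repr_class.
Qed.

Lemma formal_dist N s t : fact_dist (formal s) (formal t) <= N <-> linked N s t.
Proof.
rewrite /formal; apply: (iff_trans (fact_dist_seq_mset _ _ _)).
split; last exact: linked_map.
by move=> h; have := linked_map (repr : assocClass H -> H) h; rewrite !map_repr_class.
Qed.

(** In a reduced monoid, factorizations are lists of atoms up to permutation. *)
Lemma factorizationsP a z :
  factorizations a z <-> exists2 s, factors a s & z = formal s.
Proof.
split=> [[Az /associated_eq za]|[s [As sa] ->]].
  exists (map repr (z : seq _)).
    split; last by rewrite /mprod big_map.
    by move=> u /mapP[c cz ->]; exact: Az.
  rewrite /formal -map_comp -[LHS]seq_mset_id; congr seq_mset.
  by rewrite map_id_in // => c _ /=; rewrite reprK.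
rewrite /formal; set c := [seq _ | _ <- s].
have pc : perm_eq (seq_mset c) c by exact: perm_eq_seq_mset.
split=> [d|].
  by rewrite (perm_mem pc) => /mapP[u us ->]; rewrite repr_class; exact: As.
apply/associated_eq; rewrite (perm_big _ pc) /= big_map -sa.
by apply: eq_bigr => u _; rewrite repr_class.
Qed.

Lemma factorizations_formal a s : factors a s -> factorizations a (formal s).
Proof. by move=> sa; apply/factorizationsP; exists s. Qed.

(** In a reduced monoid the unit is no special case: its only factorization is
the empty list. *)
Lemma lengthsP a k : lengths a k <-> exists2 s, factors a s & size s = k.
Proof.
split=> [[[/redH-> ->]|[_ _ [s [<- As ->]]]]|[s [As sa] <-]].
- by exists [::] => //; split=> //; rewrite mprod_nil.
- by exists s.
case: s As sa => [|u s] As sa.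
  by left; split=> //; rewrite -sa mprod_nil; exact: munits1.
right; split=> //; last by exists (u :: s).
by rewrite -sa mprod_cons => /munitsMl; apply: (As u (mem_head _ _)).1.
Qed.

Lemma factors_nil s : factors 1 s -> s = [::].
Proof.
case: s => // u s [As]; rewrite mprod_cons => e.
by case: (As u (mem_head _ _)) => []; case; exists (mprod s).
Qed.

Lemma UsetP k l : Uset H k l <->
  exists s t, [/\ factors (mprod s) t, forall u, u \in s -> atom u,
                  size s = k & size t = l].
Proof.
split=> [[L [[a _ <-] /lengthsP[s [As sa] <-]] /lengthsP[t ta <-]]|].
  by exists s, t; rewrite sa.
move=> [s [t [ta As <- <-]]]; exists (lengths (mprod s)).
  by split; [exists (mprod s) | apply/lengthsP; exists s].
by apply/lengthsP; exists t.
Qed.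

Lemma factorial_of_unique :
  (forall a, exists s, factors a s) ->
  (forall a s t, factors a s -> factors a t -> perm_eq s t) ->
  factorial_monoid H.
Proof.
move=> ex uq a; case: (ex a) => s sa; exists (formal s).
split; first exact: factorizations_formal.
by move=> z /factorizationsP[t ta ->]; apply/formal_eqP; exact: uq ta.
Qed.

Lemma factorial_unique : factorial_monoid H ->
  forall a s t, factors a s -> factors a t -> perm_eq s t.
Proof.
move=> fH a s t sa ta; case: (fH a) => z [_ uz]; apply/formal_eqP.
by rewrite -(uz _ (factorizations_formal sa)) (uz _ (factorizations_formal ta)).
Qed.

Lemma factorial_half_factorial : factorial_monoid H -> half_factorial H.
Proof.
move=> fH a; case: (fH a) => z [/factorizationsP[s sa _] _].
exists (size s); apply/seteqP; split=> k /=; last first.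
  by move=> ->; apply/lengthsP; exists s.
by move=> /lengthsP[t ta <-]; apply/perm_size/(factorial_unique fH ta sa).
Qed.

(** By cancellation, two factorizations cannot differ in just one atom. *)
Lemma fact_dist_le1 a s t : factors a s -> factors a t ->
  linked 1 s t -> perm_eq s t.
Proof.
move=> sa ta [w [p [q [es et]]]].
have [b [c [e1 wb pc]]] := factors_catE (factors_perm es sa).
have [b' [c' [e2 wb' qc]]] := factors_catE (factors_perm et ta).
have cc' : c = c'.
  by apply: (@ccmulI H b); rewrite -e1 e2; congr (_ * _); rewrite -wb'.2 wb.2.
rewrite -cc' in qc; rewrite (permPl es) (permPr et) perm_cat2l => {e2}.
case: p pc {es} => [|u [|//]] pc; case: q qc {et} => [|v [|//]] qc _ _ //.
- by move: pc.2 qc; rewrite mprod_nil => <- /factors_nil.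
- by move: qc.2 pc; rewrite mprod_nil => <- /factors_nil.
- by move: pc.2 qc.2; rewrite !mprod_seq1 => -> ->.
Qed.

End ReducedMonoids.

(** * Transfer homomorphisms of reduced monoids *)

Section ExtremaOfNatSets.
Variable R : realType.
Implicit Types A B : set nat.
Local Open Scope ereal_scope.

Lemma lee_nat m n : (m%:R%:E <= n%:R%:E :> \bar R) = (m <= n)%N.
Proof. by rewrite lee_fin ler_nat. Qed.

Lemma nsup_ge A n : A n -> n%:R%:E <= nsup R A.
Proof. by move=> An; apply: ereal_sup_ubound; exists n. Qed.

Lemma nsup_le A (x : \bar R) : (forall n, A n -> n%:R%:E <= x) -> nsup R A <= x.
Proof. by move=> Ax; apply: ge_ereal_sup => _ [n An <-]; exact: Ax. Qed.

Lemma ninf_le A n : A n -> ninf R A <= n%:R%:E.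
Proof. by move=> An; apply: ereal_inf_lbound; exists n. Qed.

Lemma ninf_ge A (x : \bar R) : (forall n, A n -> x <= n%:R%:E) -> x <= ninf R A.
Proof. by move=> Ax; apply: le_ereal_inf_tmp => _ [n An <-]; exact: Ax. Qed.

Lemma ninf_attained A n : A n ->
  exists m, [/\ A m, ninf R A = m%:R%:E & forall k, A k -> (m <= k)%N].
Proof.
move=> An; have exA : exists k, `[< A k >] by exists n; apply/asboolP.
case: (ex_minnP exA) => m /asboolP Am minm.
have lem k : A k -> (m <= k)%N by move=> Ak; apply/minm/asboolP.
exists m; split=> //; apply/le_anti/andP; split; first exact: ninf_le.
by apply: ninf_ge => k /lem; rewrite lee_nat.
Qed.

Lemma nsup_attained A b n : A n -> (forall k, A k -> (k <= b)%N) ->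
  exists m, [/\ A m, nsup R A = m%:R%:E & forall k, A k -> (k <= m)%N].
Proof.
move=> An Ab; have exA : exists k, `[< A k >] by exists n; apply/asboolP.
have bA k : `[< A k >] -> (k <= b)%N by move/asboolP/Ab.
case: (ex_maxnP exA bA) => m /asboolP Am maxm.
have lem k : A k -> (k <= m)%N by move=> Ak; apply/maxm/asboolP.
exists m; split=> //; apply/le_anti/andP; split; last exact: nsup_ge.
by apply: nsup_le => k /lem; rewrite lee_nat.
Qed.

(** With [nsup_attained], this leaves two cases for a supremum of naturals. *)
Lemma nsup_unbounded A : (forall b, exists2 k, A k & (b < k)%N) -> nsup R A = +oo.
Proof.
move=> uA; apply/eqyP => r r0; have [k Ak rk] := uA (Num.bound r).
apply: le_trans (nsup_ge Ak); rewrite lee_fin.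
by apply/ltW/(lt_le_trans (archi_boundP (ltW r0))); rewrite ler_nat ltnW.
Qed.

End ExtremaOfNatSets.

Section TransferHomomorphisms.
Variables (H D : ccMonoidType) (theta : H -> D).
Hypotheses (redH : reduced H) (redD : reduced D) (tr : transfer_hom theta).
Implicit Types (a b u v : H) (c d : D) (s : seq H) (t : seq D).
Local Open Scope group_scope.

Lemma transferM : {morph theta : u v / u * v}.
Proof. by case: tr => -[]. Qed.

Lemma transfer1 : theta 1 = 1.
Proof. by case: tr => -[]. Qed.

Lemma transfer_onto d : exists h, theta h = d.
Proof.
case: tr => _ onto _ _; case: (onto d) => h [u /redD-> ->].
by exists h; rewrite mulg1.
Qed.

Lemma transfer_eq1 u : theta u = 1 -> u = 1.
Proof.
case: tr => _ _ preU _ u1; apply: redH.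
suff: (theta @^-1` @munits D)%classic u by rewrite preU.
by rewrite /= u1; exact: munits1.
Qed.

Lemma transfer_split u c d : theta u = c * d ->
  exists v w, [/\ u = v * w, theta v = c & theta w = d].
Proof.
case: tr => _ _ _ sp /sp[v [w [-> vb wc]]]; exists v, w.
by split=> //; apply/(associated_eq redD).
Qed.

Lemma transfer_prod s : theta (mprod s) = mprod (map theta s).
Proof. by rewrite /mprod (big_morph theta transferM transfer1) big_map. Qed.

Lemma munits_transfer u : munits (theta u) <-> munits u.
Proof.
split=> [/redD/transfer_eq1->|/redH->]; first exact: munits1.
by rewrite transfer1; exact: munits1.
Qed.

Lemma atom_transfer u : atom (theta u) <-> atom u.
Proof.
split=> [[nU irr]|[nU irr]]; split; do ?by move/munits_transfer.
  move=> v w e; have := irr (theta v) (theta w).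
  by rewrite -transferM -e => /(_ erefl)[]/munits_transfer; [left|right].
move=> c d /transfer_split[v [w [/irr e <- <-]]].
by case: e => /munits_transfer; [left|right].
Qed.

Lemma factors_transfer a s : factors a s -> factors (theta a) (map theta s).
Proof.
move=> [As <-]; split; last by rewrite transfer_prod.
by move=> _ /mapP[u us ->]; apply/atom_transfer/As.
Qed.

(** The splitting property of [theta] is applied to one atom at a time. *)
Lemma factors_lift a t : factors (theta a) t ->
  exists2 s, factors a s & map theta s = t.
Proof.
elim: t a => [|d t IH] a [At]; first rewrite mprod_nil => /esym/transfer_eq1->.
  by exists [::] => //; split=> //; rewrite mprod_nil.
rewrite mprod_cons => /esym/transfer_split[v [w [-> vd wt]]].
have [] := IH w; first by split=> // u ut; apply: At; rewrite inE ut orbT.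
move=> s sw <-; exists (v :: s); last by rewrite /= vd.
have Av : atom v by apply/atom_transfer; rewrite vd; apply: At; rewrite mem_head.
exact: factors_cat (factors1 Av) sw.
Qed.

Lemma lengths_transfer a : lengths (theta a) = lengths a.
Proof.
apply/seteqP; split=> k /lengthsP [] // s sa <-; apply/lengthsP => //.
  by have [r ra <-] := factors_lift sa; exists r; rewrite ?size_map.
by exists (map theta s); [exact: factors_transfer | rewrite size_map].
Qed.

Lemma system_of_lengths_transfer : system_of_lengths H = system_of_lengths D.
Proof.
apply/seteqP; split=> _ [a _ <-].
  by exists (theta a) => //; exact: lengths_transfer.
by have [h <-] := transfer_onto a; exists h => //; rewrite lengths_transfer.
Qed.

Lemma Uset_transfer k : Uset H k = Uset D k.
Proof. by rewrite /Uset system_of_lengths_transfer. Qed.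

Lemma half_factorial_transfer : half_factorial D -> half_factorial H.
Proof. by move=> hD a; case: (hD (theta a)) => k; rewrite lengths_transfer; exists k. Qed.

Lemma range_lengths_transfer (T : Type) (f : set nat -> T) :
  [set f (lengths a) | a in [set: H]]%classic = [set f (lengths d) | d in [set: D]]%classic.
Proof.
apply/seteqP; split=> _ [a _ <-].
  by exists (theta a) => //; rewrite lengths_transfer.
by have [h <-] := transfer_onto a; exists h => //; rewrite lengths_transfer.
Qed.

Lemma elasticity_transfer (R : realType) : elasticity R H = elasticity R D.
Proof. by rewrite /elasticity range_lengths_transfer. Qed.

Lemma fact_image_formal s : fact_image theta (formal s) = formal (map theta s).
Proof.
rewrite /fact_image /formal map_mset_seq -!map_comp; congr seq_mset.
by apply: eq_map => u /=; rewrite repr_class.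
Qed.

Lemma factorizations_transfer a z :
  factorizations a z -> factorizations (theta a) (fact_image theta z).
Proof.
move=> /(factorizationsP redH)[s sa ->]; rewrite fact_image_formal.
exact/(factorizations_formal redD)/factors_transfer.
Qed.

Lemma fact_dist_transfer a b x y N : factorizations a x -> factorizations b y ->
  fact_dist x y <= N -> fact_dist (fact_image theta x) (fact_image theta y) <= N.
Proof.
move=> /(factorizationsP redH)[r _ ->] /(factorizationsP redH)[s _ ->].
move=> /(formal_dist redH) rs; rewrite !fact_image_formal.
by apply/(formal_dist redD); exact: linked_map.
Qed.

(** [cat_deg_elt R a] is the infimum of the [N] with [connected a N]. *)
Definition connected (M : ccMonoidType) (a : M) N := forall z z',
  factorizations a z -> factorizations a z' -> chained (factorizations a) N z z'.

Lemma connected_transfer a N : connected a N -> connected (theta a) N.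
Proof.
move=> ca _ _ /(factorizationsP redD)[t ta ->] /(factorizationsP redD)[t' ta' ->].
have [s sa <-] := factors_lift ta; have [s' sa' <-] := factors_lift ta'.
rewrite -!fact_image_formal.
have := ca _ _ (factorizations_formal redH sa) (factorizations_formal redH sa').
move: (factorizations_formal redH sa); move: (formal s) (formal s') => z z' za ch.
move: z z' ch za; apply: chained_ind => [z _|x y z ya xy _ IH xa].
  exact: chained_refl.
apply: chained_step (IH ya); first exact: factorizations_transfer.
exact: fact_dist_transfer xa ya xy.
Qed.

Definition fiber_connected a N := forall z z',
  factorizations a z -> factorizations a z' ->
  fact_image theta z = fact_image theta z' ->
  chained (factorizations a `&` [set y | fact_image theta y = fact_image theta z])%classic
    N z z'.

(** A step downstairs replaces a part [p] of the current factorization by [q]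
with the same product.  The atoms above [p] have a product whose image is that of
[q], so [q] lifts to a factorization of this product.  The end of the lifted chain
has the required image, and the fibre takes care of the rest. *)
Lemma connected_lift a N M : connected (theta a) N -> fiber_connected a M ->
  connected a (maxn N M).
Proof.
move=> ca fa z z' za za'.
suff [y ya [ey zy]] : exists2 y, factorizations a y &
    fact_image theta y = fact_image theta z' /\
    chained (factorizations a) (maxn N M) z y.
  apply: chained_trans zy _; apply: chained_mono (fa _ _ ya za' ey).
    exact: leq_maxr.
  exact: subIsetl.
have := ca _ _ (factorizations_transfer za) (factorizations_transfer za').
move zE: (fact_image theta z) => w; move: (fact_image theta z') => w' ch.
move: w w' ch z za zE {za' z'}; apply: chained_ind => [w z za zE|].
  by exists z => //; split=> //; exact: chained_refl.
move=> x y w yt xy _ IH z za e.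
have [t ta yE] := (factorizationsP redD _ _).1 yt.
have [s sa zE] := (factorizationsP redH _ _).1 za.
rewrite -{}e {}yE {}zE fact_image_formal in xy IH *.
move/(formal_dist redD): xy => [c [p [q [es et ps qs]]]].
have [s' es' e'] := perm_map_lift es.
pose sc := take (size c) s'; pose sp := drop (size c) s'.
have ssp : sc ++ sp = s' by exact: cat_take_drop.
have [scc spp] : map theta sc = c /\ map theta sp = p.
  by rewrite map_take map_drop e' take_size_cat // drop_size_cat.
have {}sa := factors_perm es' sa; rewrite -ssp in sa.
have {}ta := factors_perm et ta.
have [b1 [b2 [aE sb1 sb2]]] := factors_catE sa.
have [c1 [c2 [tE tc1 tc2]]] := factors_catE ta.
have bc : theta b2 = c2.
  apply: (@ccmulI D c1); rewrite -tE aE transferM; congr (_ * _).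
  by rewrite -tc1.2 -scc -transfer_prod sb1.2.
rewrite -bc in tc2; have [sq qb2 sqE] := factors_lift tc2.
have qa : factors a (sc ++ sq) by rewrite aE; exact: factors_cat.
have [||y' ya [yw zy]] := IH (formal (sc ++ sq)).
- exact: factorizations_formal.
- by rewrite fact_image_formal map_cat scc sqE; apply/(formal_eqP redD); rewrite perm_sym.
exists y' => //; split=> //; apply: chained_step zy.
  exact: factorizations_formal.
apply/(formal_dist redH); exists sc, sp, sq; rewrite ssp es' perm_refl.
by rewrite -(size_map theta) spp -(size_map theta sq) sqE !leq_max ps qs.
Qed.

Local Open Scope ereal_scope.

Lemma cat_deg_transfer (R : realType) M : (forall a, fiber_connected a M) ->
  M%:R%:E <= cat_deg R D -> cat_deg R H = cat_deg R D.
Proof.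
move=> fM MD; apply/le_anti/andP; split; apply: ge_ereal_sup => _ [a _ <-].
  have [[N Na]|nN] := pselect (exists N, connected (theta a) N).
    have [m [/= ma mE _]] := @ninf_attained R [set N | connected (theta a) N]%classic N Na.
    have mD : m%:R%:E <= cat_deg R D.
      by rewrite -mE; apply: ereal_sup_ubound; exists (theta a).
    apply: le_trans (_ : (maxn m M)%:R%:E <= _).
      apply: ninf_le => /=; exact: connected_lift.
    by rewrite /maxn; case: ifP.
  apply: le_trans (leey _) (_ : +oo <= _).
  apply: le_trans (_ : cat_deg_elt R (theta a) <= _); last first.
    by apply: ereal_sup_ubound; exists (theta a).
  by apply: ninf_ge => N Na; case: nN; exists N.
have [h <-] := transfer_onto a.
apply: le_trans (_ : cat_deg_elt R h <= _); last first.
  by apply: ereal_sup_ubound; exists h.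
by apply: ninf_ge => N Nh; apply: ninf_le; exact: connected_transfer.
Qed.

Lemma cat_deg_fib_le (R : realType) M : (forall a, fiber_connected a M) ->
  cat_deg_fib R theta <= M%:R%:E.
Proof.
by move=> fM; apply: ge_ereal_sup => _ [a _ <-]; apply: ninf_le; exact: fM.
Qed.

End TransferHomomorphisms.

(** * The monoid of product-K sequences and the canonical map *)

Section ProductSequences.
Variables (G : groupType) (K : normalClosed G).
Implicit Types (x y g h : G) (w : seq G) (A B : {mset G}%mset).
Implicit Types (S T U V : prodMonoid K) (s t : seq (prodMonoid K)).
Local Open Scope mset_scope.
Local Open Scope group_scope.

Lemma phi_eq1 x : (phi K x == 1) = (x \in K).
Proof.
apply/eqP/idP => [e|Kx].
  by have /phiP : phi K 1 = phi K x; rewrite ?invg1 ?mul1g // e (fst (phi_morph K)).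
by rewrite -(fst (phi_morph K)); apply/esym/phiP; rewrite invg1 mul1g.
Qed.

Lemma phi_prod w : phi K (\prod_(g <- w) g) = \prod_(q <- map (phi K) w) q.
Proof. by rewrite (big_morph (phi K) (snd (phi_morph K)) (fst (phi_morph K))) big_map. Qed.

(** By normality, membership of a product in [K] is invariant under cyclic
rotation of the factors. *)
Lemma mem_normalC x y : (x * y \in K) = (y * x \in K).
Proof.
suff sub a b : a * b \in K -> b * a \in K by apply/idP/idP; exact: sub.
by move/(@Defs.gpredJ _ K _ a); rewrite conjgE -mulgA mulKg.
Qed.

Lemma mem_normal_rot (w1 w2 : seq G) :
  (\prod_(g <- w1 ++ w2) g \in K) = (\prod_(g <- w2 ++ w1) g \in K).
Proof. by rewrite !big_cat mem_normalC. Qed.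

Lemma product_in_word w : \prod_(g <- w) g \in K -> seq_mset w \in product_in K.
Proof. by move=> Kw; apply/product_inP; exists w. Qed.

(** An element of [B_K(G)] given by an ordering that witnesses it. *)
Definition word_seq w (Kw : \prod_(g <- w) g \in K) : prodMonoid K :=
  ProdSeq (product_in_word Kw).

Lemma seq_of_word S : exists w (Kw : \prod_(g <- w) g \in K), S = word_seq Kw.
Proof.
have /product_inP[w wS Kw] := seq_ofP S.
by exists w, Kw; apply: val_inj; apply: esym.
Qed.

Lemma seq_of_inj : injective (@seq_of G K).
Proof. exact: val_inj. Qed.

Lemma seq_ofM S T : seq_of (S * T) = seq_of S `+` seq_of T.
Proof. by []. Qed.

Lemma seq_of1 : seq_of (1 : prodMonoid K) = mset0.
Proof. by []. Qed.

Lemma seq_of_prod s : seq_of (mprod s) = \prod_(S <- s) seq_of S.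
Proof. exact: (big_morph (@seq_of G K) seq_ofM seq_of1). Qed.

Lemma size_seq_ofM S T : size (seq_of (S * T)) = (size (seq_of S) + size (seq_of T))%N.
Proof. by rewrite seq_ofM size_msetD. Qed.

Lemma size_seq_of_gt0 S : (0 < size (seq_of S)) = (S != 1).
Proof. by rewrite lt0n size_mset_eq0 -(inj_eq seq_of_inj). Qed.

Lemma prodMonoid_reduced : reduced (prodMonoid K).
Proof.
move=> S [T ST1]; apply/eqP; rewrite -[_ == _]negbK -size_seq_of_gt0 -leqNgt.
have := size_seq_ofM S T; rewrite ST1 seq_of1 size_mset0 /=; lia.
Qed.

Lemma atomP S : atom S <-> S <> 1 /\ forall T U, S = T * U -> T = 1 \/ U = 1.
Proof.
have U1 : munits (1 : prodMonoid K) := @munits1 _.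
split=> [AS|[nS irr]].
  split=> [|T U /(AS.2)[] /prodMonoid_reduced]; [exact: atom_neq1 |by left|by right].
split=> [/prodMonoid_reduced//|T U /irr[->|->]]; by [left|right].
Qed.

Lemma prodMonoid_atomic S : exists s, factors S s.
Proof.
have [n] := ubnP (size (seq_of S)); elim: n S => // n IH S Sn.
have [->|/eqP nS] := eqVneq S 1; first by exists [::]; split; rewrite ?mprod_nil.
have [AS|] := pselect (atom S); first by exists [:: S]; exact: factors1.
move/atomP/not_andP => -[//|/existsNP[T /existsNP[U]]].
move=> /not_implyP[e /not_orP[/eqP nT /eqP nU]].
move: Sn; rewrite e size_seq_ofM.
rewrite -size_seq_of_gt0 in nT; rewrite -size_seq_of_gt0 in nU => Sn.
have [|s sT] := IH T; first by lia.
have [|t tU] := IH U; first by lia.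
by exists (s ++ t); exact: factors_cat.
Qed.

(** The main link between [G] and [G/K]: an ordering of the image with product
one comes from an ordering of [A], whose product then lies in [K]. *)
Lemma product_in_phi A :
  (map_mset (phi K) A \in product_in (triv_normal (quotGroup K))) = (A \in product_in K).
Proof.
apply/idP/idP => [|/map_phi_product_in//].
move/product_inP => [t /eq_seq_msetP]; rewrite perm_sym => /perm_map_lift[s' es' <-].
rewrite -phi_prod inE /= => /eqP/eqP; rewrite phi_eq1 => Ks.
apply/product_inP; exists s' => //; rewrite -[RHS]seq_mset_id.
by apply/eq_seq_msetP; rewrite perm_sym.
Qed.

Lemma phi_seqM : {morph @phi_seq G K : S T / S * T}.
Proof. by move=> S T; apply: val_inj => /=; rewrite map_msetD. Qed.

Lemma map_mset_onto (B : {mset quotGroup K}) : exists A, map_mset (phi K) A = B.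
Proof.
exists (seq_mset (map repr (B : seq _))).
rewrite map_mset_seq -map_comp map_id_in ?seq_mset_id // => q _; exact: phi_repr.
Qed.

Lemma map_mset_split (A : {mset G}) (B C : {mset quotGroup K}) :
  map_mset (phi K) A = B `+` C -> exists A1 A2,
  [/\ A = A1 `+` A2, map_mset (phi K) A1 = B & map_mset (phi K) A2 = C].
Proof.
rewrite -[B]seq_mset_id -[C]seq_mset_id -seq_mset_cat => /eq_seq_msetP/perm_map_lift.
case=> s es e; exists (seq_mset (take (size B) s)), (seq_mset (drop (size B) s)).
rewrite -seq_mset_cat cat_take_drop !map_mset_seq map_take map_drop e.
rewrite take_size_cat // drop_size_cat //; split=> //.
by rewrite -[A]seq_mset_id; exact/eq_seq_msetP.
Qed.

End ProductSequences.

Section CanonicalTransfer.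
Variables (G : groupType) (K : normalClosed G).
Local Open Scope mset_scope.
Local Open Scope group_scope.
Let Q := quotGroup K.

Lemma phi_seq_transfer : transfer_hom (@phi_seq G K).
Proof.
split.
- by split; [apply: val_inj; exact: map_mset0 | exact: phi_seqM].
- move=> d; have [A Ad] := map_mset_onto (seq_of d).
  have KA : A \in product_in K by rewrite -product_in_phi Ad; exact: seq_ofP.
  exists (ProdSeq KA), 1; first exact: munits1.
  by rewrite mulg1; apply: val_inj; rewrite /= Ad.
- apply/seteqP; split=> S /=; last first.
    move/prodMonoid_reduced=> ->.
    suff -> : phi_seq (1 : prodMonoid K) = 1 by exact: munits1.
    by apply: val_inj; exact: map_mset0.
  move/prodMonoid_reduced => e; suff -> : S = 1 by exact: munits1.
  apply/eqP; rewrite -[_ == _]negbK -size_seq_of_gt0.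
  have : size (seq_of (phi_seq S)) = 0%N by rewrite e size_mset0.
  by rewrite /= size_seq_mset size_map => ->.
move=> S T U /(congr1 (@seq_of _ _)); rewrite seq_ofM => /map_mset_split[A1 [A2 [eA e1 e2]]].
have K1 : A1 \in product_in K by rewrite -product_in_phi e1; exact: seq_ofP.
have K2 : A2 \in product_in K by rewrite -product_in_phi e2; exact: seq_ofP.
exists (ProdSeq K1), (ProdSeq K2); split; first exact: val_inj.
  by apply/(associated_eq (@prodMonoid_reduced _ _))/val_inj.
by apply/(associated_eq (@prodMonoid_reduced _ _))/val_inj.
Qed.

End CanonicalTransfer.

(** * Unions of sets of lengths are intervals *)

Section AdjacentLetters.
Variable T : choiceType.
Implicit Types (x y : T) (w p r : seq T) (A : {mset T}%mset) (t : seq {mset T}%mset).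
Local Open Scope mset_scope.
Local Open Scope group_scope.

Lemma mulmsetE A B x : (A * B : {mset T}) x = (A x + B x)%N.
Proof. by rewrite -[A * B]/(A `+` B) msetE2. Qed.

Lemma mset_prodE t x : (\prod_(A <- t) A) x = (\sum_(A <- t) A x)%N.
Proof. by elim: t => [|A t IH]; rewrite ?big_nil ?big_cons ?mulmsetE ?IH // mset0E. Qed.

Lemma longest_prefix (P : pred (seq T)) w : P [::] -> ~~ P w ->
  exists p y r, [/\ w = p ++ y :: r, P p & ~~ P (rcons p y)].
Proof.
move=> P0; elim/last_ind: w => [|w y IH]; first by rewrite P0.
have [Pw|/IH[p [z [r [-> Pp Pz]]]]] := boolP (P w); first by exists w, y, [::]; rewrite cats1.
by exists p, z, (rcons r y); rewrite -rcons_cons -rcons_cat.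
Qed.

(** The witness is the longest prefix contained in some member [nth mset0 t i]:
its last letter is [x] and the next letter is [y].  As [nth mset0 t i] has too few
copies of [y] for the longer prefix, another member contains [y]. *)
Lemma split_word w t : seq_mset w `<=` \prod_(A <- t) A ->
  (exists2 i, i < size t & seq_mset w `<=` nth mset0 t i) \/ t = [::] \/
  exists p x y r i j, [/\ w = p ++ x :: y :: r, i != j,
                         x \in nth mset0 t i & y \in nth mset0 t j].
Proof.
case: t => [|A0 t']; first by right; left.
move: (A0 :: t') (isT : 0 < size (A0 :: t')) => {A0 t'} t t0 wt.
pose P w := has (fun A => seq_mset w `<=` A) t.
have [Pw|nPw] := boolP (P w).
  by left; move/(has_nthP mset0): Pw.
have P0 : P [::].
  case: t t0 {wt nPw} @P => // A t _ /=.
  by rewrite (_ : seq_mset _ = mset0) ?msub0set //; apply/msetP=> x; rewrite mset_seqE mset0E.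
right; right; have [p [y [r [wE Pp nPy]]]] := longest_prefix P0 nPw.
have some_j z : (0 < \sum_(A <- t) A z)%N -> exists2 j, j < size t & z \in nth mset0 t j.
  rewrite lt0n sum_nat_seq_neq0 => /hasP[A /(nthP mset0)[j jt <-]] /=.
  by rewrite -lt0n mset_gt0; exists j.
elim/last_ind: p wE Pp nPy => [|p x _] wE Pp nPy.
  case/negP: nPy; have [|j jt yj] := some_j y.
    rewrite -mset_prodE; move/msubsetP: wt => /(_ y); apply: leq_trans.
    by rewrite mset_seqE wE /= eqxx.
  apply/(has_nthP mset0); exists j => //=; rewrite mset_cons.
  apply/msubsetP => z; rewrite !msetE2 msetnE mset_seqE /= addn0.
  by case: eqP => // ->; rewrite mset_gt0.
move/(has_nthP mset0): Pp => [i it pi].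
have xi : x \in nth mset0 t i.
  by rewrite (msubset_subset pi) // -mset_gt0 mset_seqE -cats1 count_cat /= eqxx; lia.
have yi : (nth mset0 t i y < count_mem y (rcons (rcons p x) y))%N.
  rewrite ltnNge; apply: contra nPy => yi; apply/(has_nthP mset0); exists i => //.
  apply/msubsetP => z; rewrite mset_seqE.
  have [->//|zy] := eqVneq z y.
  move/msubsetP: pi => /(_ z); rewrite mset_seqE -[rcons (rcons _ _) _]cats1 count_cat /=.
  by rewrite eq_sym (negPf zy) !addn0.
have : (nth mset0 t i y < \sum_(A <- t) A y)%N.
  rewrite -mset_prodE; move/msubsetP: wt => /(_ y); apply: leq_trans.
  apply: leq_trans yi _; rewrite mset_seqE wE -[rcons (rcons _ _) _]cats1 !count_cat /=; lia.
rewrite (big_nth mset0) big_mkord (bigD1 (Ordinal it)) //= -[X in X < _]addn0 ltn_add2l.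
rewrite lt0n sum_nat_eq0 negb_forall => /existsP[j]; rewrite negb_imply => /andP[ji yj].
exists p, x, y, r, i, j; split=> //; first by rewrite wE -cats1 -catA.
  by apply: contra ji => /eqP e; apply/eqP/val_inj.
by rewrite -mset_gt0 lt0n.
Qed.

(** A word contained in one member of [t] is removed from both sides; this empties
at most one member.  As [t] has more non-empty members than there are words, the
process stops at a word that no member contains. *)
Lemma split_adjacent ws t : seq_mset (flatten ws) = \prod_(A <- t) A ->
  (size ws < count (predC1 mset0) t)%N ->
  exists p x y r i j, [/\ p ++ x :: y :: r \in ws, i != j,
                         x \in nth mset0 t i & y \in nth mset0 t j].
Proof.
elim: ws t => [|w ws IH] t e lt.
  suff : count (predC1 mset0) t = 0%N by lia.
  apply/eqP; rewrite -leqn0 leqNgt -has_count; apply/hasP => -[A At /=].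
  case/eqP; apply/msetP => x; rewrite [RHS]mset0E.
  have : (\prod_(A <- t) A) x = 0%N by rewrite -e mset_seqE.
  rewrite mset_prodE => /eqP; rewrite sum_nat_seq_eq0 => /allP/(_ _ At) /=.
  by move/eqP.
have wt : seq_mset w `<=` \prod_(A <- t) A.
  by rewrite -e /= seq_mset_cat; apply/msubsetP=> x; rewrite msetE2 leq_addr.
case: (split_word wt) => [[i it wi]|[t0|[p [x [y [r [i [j [wE ij xi yj]]]]]]]]].
- pose t' := set_nth mset0 t i (nth mset0 t i `\` seq_mset w).
  have [||p [x [y [r [i1 [j1 [pw ij xi yj]]]]]]] := IH t'.
  + apply/msetP => x.
    have sumD (u : seq {mset T}) : size u = size t -> \sum_(A <- u) A x =
        (nth mset0 u i x + \sum_(j < size t | j != Ordinal it) nth mset0 u j x)%N.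
      by move=> su; rewrite (big_nth mset0) big_mkord su (bigD1 (Ordinal it)).
    have st : size t' = size t by rewrite size_set_nth; apply/maxn_idPr.
    have /msetP/(_ x) := e; rewrite /= seq_mset_cat msetE2.
    rewrite mset_prodE (mset_prodE t') !sumD // nth_set_nth /= eqxx msetE2.
    move/msubsetP: wi => /(_ x) wi.
    rewrite [X in _ -> _ = _ + X](eq_bigr (fun j : 'I_(size t) => nth mset0 t j x)); last first.
      by move=> j ji; rewrite /t' nth_set_nth /= ifN.
    by move=> ex; apply: (@addnI (seq_mset w x)); rewrite addnA subnKC.
  + have := lt; rewrite /= -[t in count _ t](cat_take_drop i) (drop_nth 1 it).
    rewrite /t' set_nthE it !count_cat /=.
    by case: (nth mset0 t i != mset0); lia.
  have sub i' : nth mset0 t' i' `<=` nth mset0 t i'.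
    rewrite nth_set_nth /=; case: eqP => [->|_]; first exact: msubsetDl.
    exact: msubset_refl.
  exists p, x, y, r, i1, j1; split=> //; first by rewrite inE pw orbT.
    exact: msubset_subset xi.
  exact: msubset_subset yj.
- by rewrite t0 in lt.
by exists p, x, y, r, i, j; rewrite -wE mem_head.
Qed.

End AdjacentLetters.

Lemma perm_nth2 (T : eqType) (x0 : T) t i j : i < size t -> j < size t -> i != j ->
  exists t', perm_eq t (nth x0 t i :: nth x0 t j :: t').
Proof.
elim: t i j => // x t IH [|i] [|j] //= it jt ij.
- by exists (rem (nth x0 t j) t); rewrite perm_cons perm_to_rem ?mem_nth.
- exists (rem (nth x0 t i) t).
  rewrite perm_sym (perm_catCA [:: nth x0 t i] [:: x]) /= perm_cons perm_sym.
  by rewrite perm_to_rem ?mem_nth.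
have [//|//|//|t' e] := IH i j; exists (x :: t').
by rewrite perm_sym (perm_catCA [:: nth x0 t i; nth x0 t j] [:: x]) /= perm_cons perm_sym.
Qed.

Section MergingLetters.
Variables (G : groupType) (K : normalClosed G).
Implicit Types (x y g h : G) (w p r : seq G).
Implicit Types (S T U V : prodMonoid K) (s t : seq (prodMonoid K)).
Local Open Scope mset_scope.
Local Open Scope group_scope.

Lemma word_at S x : x \in seq_of S ->
  exists w1 w2 (Kw : \prod_(g <- w1 ++ x :: w2) g \in K), S = word_seq Kw.
Proof.
have [w [Kw ->]] := seq_of_word S.
rewrite /= -mset_gt0 mset_seqE -has_count has_pred1 => xw.
case/splitPr: xw Kw => w1 w2 Kw.
by exists w1, w2, Kw.
Qed.

Lemma merge_in_word p x y r :
  (\prod_(g <- p ++ x :: y :: r) g \in K) = (\prod_(g <- p ++ x * y :: r) g \in K).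
Proof. by rewrite !big_cat !big_cons /= !mulgA. Qed.

(** In a decomposition of the merged sequence one factor contains the letter
[x * y]; splitting this letter again gives a decomposition of the original. *)
Lemma merge_atom p x y r (Kw : \prod_(g <- p ++ x :: y :: r) g \in K)
    (Kw' : \prod_(g <- p ++ x * y :: r) g \in K) :
  atom (word_seq Kw) -> atom (word_seq Kw').
Proof.
move=> /atomP[_ irr]; apply/atomP; split.
  apply/eqP; rewrite -size_seq_of_gt0 /= size_seq_mset size_cat /=; lia.
suff sub T U : word_seq Kw' = T * U -> x * y \in seq_of T -> U = 1.
  move=> T U e; have : x * y \in seq_of (word_seq Kw').
    by rewrite -mset_gt0 mset_seqE count_cat /= eqxx; lia.
  rewrite e seq_ofM in_msetD => /orP[/(sub _ _ e)|]; first by right.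
  by move: e; rewrite ccmulC => /sub e /e; left.
move=> + /word_at[w1 [w2 [Kt Te]]]; rewrite Te => {T Te} e.
have Kt' : \prod_(g <- w1 ++ x :: y :: w2) g \in K by rewrite merge_in_word.
have {}e : word_seq Kw = word_seq Kt' * U.
  apply: seq_of_inj; apply/msetP => g; have /(congr1 (@seq_of _ _))/msetP/(_ g) := e.
  by rewrite !seq_ofM !msetE2 /= !mset_seqE !count_cat /=; lia.
case: (irr _ _ e) => // /(congr1 (fun S => size (seq_of S))).
by rewrite /= size_seq_mset size_mset0 size_cat /=; lia.
Qed.

(** Rotate a word for [S] so that it ends with [x] and a word for [T] so that it
starts with [y]; in the concatenation the two letters are adjacent. *)
Lemma merge_product S T x y : x \in seq_of S -> y \in seq_of T ->
  exists2 V : prodMonoid K, V <> 1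
    & seq_of V `+` seq_mset [:: x; y] = seq_of S `+` seq_of T `+` seq_mset [:: x * y].
Proof.
move=> /word_at[a1 [a2 [Ka ->]]] /word_at[b1 [b2 [Kb ->]]].
have Kw : \prod_(g <- (a2 ++ a1) ++ x * y :: b2 ++ b1) g \in K.
  rewrite -merge_in_word.
  have -> : (a2 ++ a1) ++ x :: y :: b2 ++ b1 = (a2 ++ a1 ++ [:: x]) ++ (y :: b2) ++ b1.
    by rewrite -!catA.
  rewrite big_cat gpredM //; last by rewrite mem_normal_rot.
  by rewrite mem_normal_rot -catA.
exists (word_seq Kw); last apply/msetP => g.
  apply/eqP; rewrite -size_seq_of_gt0 /= size_seq_mset !size_cat /=; lia.
rewrite /= !msetE2 !mset_seqE !count_cat /= !count_cat; lia.
Qed.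

(** Each element of [s] comes with a word whose product lies in [K], and
adjacency of letters refers to these words. *)
Lemma words_of s : exists ws,
  [/\ seq_mset (flatten ws) = seq_of (mprod s), size ws = size s
    & forall w, w \in ws -> exists Kw : \prod_(g <- w) g \in K, word_seq Kw \in s].
Proof.
elim: s => [|S s [ws [e sz Ks]]].
  exists [::]; split=> //; rewrite mprod_nil seq_of1; apply/msetP => x.
  by rewrite mset_seqE mset0E.
have [w [Kw SE]] := seq_of_word S; exists (w :: ws); split=> /=.
- by rewrite seq_mset_cat e mprod_cons seq_ofM SE.
- by rewrite sz.
move=> w'; rewrite inE => /predU1P[->|/Ks[Kw' ws']]; first by exists Kw; rewrite SE mem_head.
by exists Kw'; rewrite inE ws' orbT.
Qed.

(** One merging step.  The fused sequence need not be an atom, but it is not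
empty, so at most one factor is lost. *)
Lemma shorten_factorizations s t : (forall U, U \in s -> atom U) ->
  factors (mprod s) t -> (size s < size t)%N ->
  exists s' t', [/\ (forall U, U \in s' -> atom U), factors (mprod s') t',
    size s' = size s, (size t <= (size t').+1)%N &
    (size (seq_of (mprod s')%g) < size (seq_of (mprod s)%g))%N].
Proof.
move=> As [At tE] lt.
have [ws [wsE szs Kws]] := words_of s.
have [||p [x [y [r [i [j [pw ij xi yj]]]]]]] := @split_adjacent _ ws (map (@seq_of _ _) t).
- by rewrite wsE -tE seq_of_prod big_map.
- rewrite szs count_map (@eq_in_count _ _ predT) ?count_predT //= => U /At/atom_neq1 /eqP nU.
  by rewrite /= -(inj_eq (@seq_of_inj _ K)) in nU *.
(* Out of range the default value is the empty multiset, which has no letters. *)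
have it : i < size t.
  by rewrite ltnNge; apply/negP=> it; move: xi; rewrite nth_default ?size_map // in_mset0.
have jt : j < size t.
  by rewrite ltnNge; apply/negP=> jt; move: yj; rewrite nth_default ?size_map // in_mset0.
rewrite !(nth_map 1) // in xi yj.
have [t2 pt] := perm_nth2 1 it jt ij.
have [V V1 VE] := merge_product xi yj.
have [Kw ws'] := Kws _ pw.
have Kw' : \prod_(g <- p ++ x * y :: r) g \in K by rewrite -merge_in_word.
have [v [Av vV]] := prodMonoid_atomic V.
have s_rem := perm_to_rem ws'.
pose s' := word_seq Kw' :: rem (word_seq Kw) s.
have merge : seq_of (mprod s') `+` seq_mset [:: x; y] =
             seq_of (mprod s) `+` seq_mset [:: x * y].
  apply/msetP => g; rewrite (perm_prod s_rem) !mprod_cons !seq_ofM !msetE2.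
  by rewrite !mset_seqE !count_cat /=; lia.
have s'E : mprod s' = mprod (v ++ t2).
  apply/seq_of_inj/(can_inj (msetDKBC (seq_mset [:: x; y]))); rewrite merge.
  rewrite -tE (perm_prod pt) !mprod_cons mprod_cat !seq_ofM vV.
  by rewrite [RHS]msetDAC VE msetDA [LHS]msetDAC.
exists s', (v ++ t2); split.
- move=> U; rewrite inE => /predU1P[->|/mem_rem/As//].
  exact: merge_atom (As _ ws').
- split=> // U; rewrite mem_cat => /orP[/Av//|Ut]; apply: At.
  by rewrite (perm_mem pt) !inE Ut !orbT.
- by rewrite (perm_size s_rem).
- rewrite (perm_size pt) size_cat /=.
  have : v != [::].
    by apply/eqP => v0; apply: V1; rewrite -vV v0 mprod_nil.
  by case: (v) => //= *; lia.
move/(congr1 (fun A : {mset G} => size A)): merge; rewrite !size_msetD !size_seq_mset /=; lia.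
Qed.

(** Merging is repeated until the second factorization has length [m]; lengths
can only jump upwards, or down by one, so none below the current one is skipped. *)
Lemma Uset_between s t m : (forall U, U \in s -> atom U) ->
  factors (mprod s) t -> (size s <= m <= size t)%N ->
  Uset (prodMonoid K) (size s) m.
Proof.
have [n] := ubnP (size (seq_of (mprod s))).
elim: n s t => // n IH s t sn As st /andP[sm mt].
have red := @prodMonoid_reduced _ K.
have [->|/eqP ms] := eqVneq m (size s).
  by apply/(UsetP red); exists s, s.
have [->|/eqP mt'] := eqVneq m (size t).
  by apply/(UsetP red); exists s, t.
have [|s' [t' [As' st' ss' tt' lt]]] := shorten_factorizations As st; first by lia.
rewrite -ss'; apply: (IH s' t') => //; first exact: leq_trans lt sn.
by apply/andP; split; lia.
Qed.

Lemma Uset_sym k l : Uset (prodMonoid K) k l -> Uset (prodMonoid K) l k.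
Proof.
have red := @prodMonoid_reduced _ K.
move=> /(UsetP red)[s [t [[At st] As <- <-]]]; apply/(UsetP red).
by exists t, s; split=> //; rewrite st.
Qed.

(** Multiply both factorizations by [n] copies of an atom. *)
Lemma Uset_shift k l n : (0 < k)%N -> Uset (prodMonoid K) k l ->
  Uset (prodMonoid K) (k + n) (l + n).
Proof.
have red := @prodMonoid_reduced _ K.
move=> k0 /(UsetP red)[s [t [st As sk <-]]]; apply/(UsetP red).
case: s sk As st k0 => [<-//|U s sk As st _].
exists (nseq n U ++ U :: s), (nseq n U ++ t).
have AU V : V \in nseq n U -> atom V.
  by rewrite mem_nseq => /andP[_ /eqP->]; apply: As; rewrite mem_head.
split.
- by rewrite mprod_cat; apply: factors_cat st; split.
- by move=> V; rewrite mem_cat => /orP[/AU|/As].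
- by rewrite size_cat size_nseq sk addnC.
- by rewrite size_cat size_nseq addnC.
Qed.

(** Values [m >= k] are reached from [k] upwards.  For [m < k] the symmetric
statement is needed: [k] is in [U_l], so [k + (m - l)] is in [U_m], and [k] lies
between [m] and this number. *)
Lemma Uset_interval k : (0 < k)%N -> nat_interval (Uset (prodMonoid K) k).
Proof.
have red := @prodMonoid_reduced _ K.
have up j l m : Uset (prodMonoid K) j l -> (j <= m <= l)%N -> Uset (prodMonoid K) j m.
  by move=> /(UsetP red)[s [t [st As <- <-]]]; exact: Uset_between st.
move=> k0 l m n kl kn /andP[lm mn]; have [km|mk] := leqP k m.
  by apply: up kn _; rewrite km mn.
have l0 : (0 < l)%N.
  rewrite lt0n; apply/eqP => l0; move: kl; rewrite l0 => /(UsetP red)[s [t [ts As sk]]].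
  move/size0nil => t0; move: ts; rewrite t0 => -[_]; rewrite mprod_nil => /esym s1.
  have /(factors_nil)/(congr1 size) : factors 1 s by split.
  by rewrite sk /=; lia.
apply/Uset_sym; apply: (@up _ (k + (m - l))%N); last by lia.
have := Uset_shift (m - l) l0 (Uset_sym kl).
by rewrite subnKC.
Qed.

End MergingLetters.

(** * Atoms, the Davenport constant and factoriality *)

Section Atoms.
Variables (G : groupType) (K : normalClosed G).
Implicit Types (x y g h : G) (w p r : seq G) (A B : {mset G}%mset).
Implicit Types (S T U V : prodMonoid K) (s t : seq (prodMonoid K)).
Local Open Scope mset_scope.
Local Open Scope group_scope.

Lemma word_seq_split w1 w2 (K1 : \prod_(g <- w1) g \in K) (K2 : \prod_(g <- w2) g \in K)
    w (Kw : \prod_(g <- w) g \in K) :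
  perm_eq w (w1 ++ w2) -> word_seq Kw = word_seq K1 * word_seq K2.
Proof. by move=> /eq_seq_msetP e; apply: seq_of_inj; rewrite seq_ofM /= e seq_mset_cat. Qed.

Lemma seq_of_size0 S : size (seq_of S) = 0%N -> S = 1.
Proof.
by move=> S0; apply/eqP; rewrite -[_ == _]negbK -size_seq_of_gt0 S0.
Qed.

(** Removing a letter of [K] from a word leaves its product in [K]. *)
Lemma atom_letter_in S x : atom S -> x \in seq_of S -> x \in K -> seq_of S = seq_mset [:: x].
Proof.
move=> /atomP[_ irr] /word_at[w1 [w2 [Kw e]]] Kx.
have K1 : \prod_(g <- [:: x]) g \in K by rewrite big_seq1.
have K2 : \prod_(g <- w2 ++ w1) g \in K.
  by move: (Kw); rewrite mem_normal_rot /= big_cons gpredMl.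
have SE : S = word_seq K1 * word_seq K2.
  rewrite e; apply: word_seq_split; rewrite perm_catC /= perm_cons //.
case: (irr _ _ SE) => [/(congr1 (fun T => size (seq_of T)))|e2].
  by rewrite /= size_seq_mset size_mset0.
by rewrite SE e2 mulg1.
Qed.

Lemma letter_of_size1 S : size (seq_of S) = 1%N -> exists2 x, x \in K & seq_of S = seq_mset [:: x].
Proof.
have [w [Kw ->]] := seq_of_word S; rewrite /= size_seq_mset.
by case: w Kw => [//|x [|//]] Kx _; exists x => //; rewrite big_seq1 in Kx.
Qed.

(** Of two proper factors of a sequence of size at most three, one is a single
letter, which has to lie in [K]. *)
Lemma small_atom S : S <> 1 -> (size (seq_of S) <= 3)%N ->
  (forall x, x \in seq_of S -> x \notin K) -> atom S.
Proof.
move=> nS S3 nK; apply/atomP; split=> // T U SE.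
have no1 V : {subset seq_of V <= seq_of S} -> size (seq_of V) <> 1%N.
  move=> VS /letter_of_size1[x Kx Vx]; have : x \in seq_of V.
    by rewrite Vx -mset_gt0 mset_seqE /= eqxx.
  by move/VS/nK; rewrite Kx.
have T1 : size (seq_of T) <> 1%N by apply: no1 => x xT; rewrite SE seq_ofM in_msetD xT.
have U1 : size (seq_of U) <> 1%N by apply: no1 => x xU; rewrite SE seq_ofM in_msetD xU orbT.
move: S3; rewrite SE size_seq_ofM => S3.
case: (posnP (size (seq_of T))) => [/seq_of_size0|T0]; first by left.
case: (posnP (size (seq_of U))) => [/seq_of_size0|U0]; first by right.
lia.
Qed.

Lemma small_word_atom w (Kw : \prod_(g <- w) g \in K) : (0 < size w <= 3)%N ->
  all [predC K] w -> atom (word_seq Kw).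
Proof.
move=> /andP[w0 w3] /allP nK; apply: small_atom.
- by apply/eqP; rewrite -size_seq_of_gt0 /= size_seq_mset.
- by rewrite /= size_seq_mset.
move=> x; rewrite /= -mset_gt0 mset_seqE -has_count has_pred1; exact: nK.
Qed.

(** Letters of [K] count twice, so that the atoms of size one have weight two. *)
Definition weight S := (size (seq_of S) + count [in K] (seq_of S))%N.

Lemma weightM S T : weight (S * T) = (weight S + weight T)%N.
Proof.
by rewrite /weight size_seq_ofM seq_ofM (permP (perm_msetD _ _)) count_cat addnACA.
Qed.

Lemma weight_mprod s : weight (mprod s) = (\sum_(U <- s) weight U)%N.
Proof.
elim: s => [|U s IH]; last by rewrite mprod_cons weightM IH big_cons.
by rewrite mprod_nil big_nil /weight seq_of1 enum_mset0.
Qed.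

Lemma weight_atom_ge2 S : atom S -> (2 <= weight S)%N.
Proof.
move=> AS; have : S != 1 by apply/eqP/atom_neq1.
rewrite -size_seq_of_gt0 /weight; case E: (size _) => [//|[|n]] _ //.
have [x Kx SE] := letter_of_size1 E.
suff : has [in K] (seq_of S) by rewrite has_count; lia.
by apply/hasP; exists x => //; rewrite SE -mset_gt0 mset_seqE /= eqxx.
Qed.

Lemma weight_atom_le d S : atom S -> (2 <= d)%N -> (size (seq_of S) <= d)%N ->
  (weight S <= d)%N.
Proof.
move=> AS d2 Sd; rewrite /weight.
have [/hasP[x xS Kx]|] := boolP (has [in K] (seq_of S)); last first.
  by rewrite has_count -leqNgt leqn0 => /eqP->; rewrite addn0.
rewrite (atom_letter_in AS xS Kx) size_seq_mset (permP (perm_eq_seq_mset _)) /=.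
by rewrite Kx.
Qed.

(** The weight of [a] is at least [2 * size t] and at most [size s * d]. *)
Lemma lengths_ratio d a s t : (2 <= d)%N -> (forall U, atom U -> (size (seq_of U) <= d)%N) ->
  factors a s -> factors a t -> (2 * size t <= size s * d)%N.
Proof.
move=> d2 dU [As sa] [At ta].
apply: (@leq_trans (weight a)).
  rewrite -ta weight_mprod mulnC -sum1_size big_distrl /= big_seq [leqRHS]big_seq.
  by apply: leq_sum => U /At/weight_atom_ge2; rewrite mul1n.
rewrite -sa weight_mprod -sum1_size big_distrl /= big_seq [leqRHS]big_seq.
by apply: leq_sum => U /As AU; rewrite mul1n weight_atom_le // dU.
Qed.

Lemma sinv_subproof S : map_mset (fun g => g^-1) (seq_of S) \in product_in K.
Proof.
have [w [Kw ->]] := seq_of_word S; rewrite /= map_mset_seq.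
apply/product_inP; exists (rev (map (fun g => g^-1) w)).
  by apply/eq_seq_msetP; rewrite perm_rev.
suff -> : \prod_(g <- rev [seq g^-1 | g <- w]) g = (\prod_(g <- w) g)^-1 by rewrite gpredV.
elim: w {Kw} => [|g w IH]; first by rewrite !big_nil invg1.
by rewrite /= rev_cons -cats1 big_cat IH big_seq1 big_cons invgM.
Qed.

(** The sequence of inverse letters; its witness is the reversed word. *)
Definition sinv S : prodMonoid K := ProdSeq (sinv_subproof S).

Lemma sinvM S T : sinv (S * T) = sinv S * sinv T.
Proof. by apply: seq_of_inj; rewrite seq_ofM /= map_msetD. Qed.

Lemma sinvK : involutive sinv.
Proof.
move=> S; apply: seq_of_inj; rewrite /= -[seq_of S]seq_mset_id !map_mset_seq.
by rewrite -map_comp map_id_in // => g _ /=; rewrite invgK.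
Qed.

Lemma sinv1 : sinv 1 = 1.
Proof.
by apply: seq_of_inj; exact: map_mset0.
Qed.

Lemma atom_sinv S : atom S -> atom (sinv S).
Proof.
move=> /atomP[nS irr]; apply/atomP; split=> [S1|T U SE].
  by apply: nS; rewrite -[S]sinvK S1 sinv1.
have [] := irr (sinv T) (sinv U).
- by rewrite -sinvM -SE sinvK.
- by move=> T1; left; rewrite -[T]sinvK T1 sinv1.
by move=> U1; right; rewrite -[U]sinvK U1 sinv1.
Qed.

Lemma mem_inv_pair g : \prod_(h <- [:: g; g^-1]) h \in K.
Proof. by rewrite big_cons big_seq1 mulgV gpred1. Qed.

(** [U . U^-1] is also the product of the pairs [g . g^-1], for [g] in [U]. *)
Lemma mul_sinv w (Kw : \prod_(g <- w) g \in K) :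
  word_seq Kw * sinv (word_seq Kw) = mprod [seq word_seq (mem_inv_pair g) | g <- w].
Proof.
apply: seq_of_inj; rewrite seq_ofM /= map_mset_seq.
elim: w {Kw} => [|g w IH].
  by apply/msetP => h; rewrite mprod_nil seq_of1 msetE2 !mset_seqE mset0E.
rewrite /= mprod_cons seq_ofM -IH /= -!seq_mset_cat; apply/eq_seq_msetP.
by rewrite /= perm_cons -cat1s perm_catCA.
Qed.

Lemma lengths_mul_sinv U : atom U -> (forall x, x \in seq_of U -> x \notin K) ->
  lengths (U * sinv U) 2%N /\ lengths (U * sinv U) (size (seq_of U)).
Proof.
move=> AU nK; split; apply/(lengthsP (@prodMonoid_reduced _ _)).
  exists [:: U; sinv U] => //; exact: (factors_cat (factors1 AU) (factors1 (atom_sinv AU))).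
have [w [Kw UE]] := seq_of_word U.
exists [seq word_seq (mem_inv_pair g) | g <- w].
  split; last by rewrite -(mul_sinv Kw) UE.
  move=> V /mapP[g gw ->]; apply: small_word_atom => //=.
  by rewrite gpredV andbT andbb nK // UE -mset_gt0 /= mset_seqE -has_count has_pred1.
by rewrite size_map UE /= size_seq_mset.
Qed.

(** Two of the prefix products of a longer word agree in [G/K].  The segment
between them has its product in [K], and so has the rest, by normality. *)
Lemma atom_size_le n S : (forall q : seq (quotGroup K), uniq q -> (size q <= n)%N) ->
  atom S -> (size (seq_of S) <= n)%N.
Proof.
move=> Qn /atomP[_]; have [w [Kw ->]] := seq_of_word S; rewrite /= size_seq_mset => irr.
pose q := [seq phi K (\prod_(g <- take i w) g) | i <- iota 0 (size w)].
have sq : size q = size w by rewrite size_map size_iota.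
have nthq i : (i < size w)%N -> nth 1 q i = phi K (\prod_(g <- take i w) g).
  by move=> iw; rewrite (nth_map 0%N) ?size_iota // nth_iota.
rewrite -sq; apply: Qn; apply/negPn/negP => /(uniqPn 1)[i [j [ij]]].
rewrite sq => jw; rewrite !nthq ?(ltn_trans ij) // => e.
have eT : take j w = take i w ++ take (j - i) (drop i w).
  by rewrite -takeD subnKC // ltnW.
have Kmid : \prod_(g <- take (j - i) (drop i w)) g \in K.
  move: e; rewrite eT big_cat (snd (phi_morph K)) => /eqP.
  by rewrite -[X in X == _]mulg1 eq_sym => /eqP/mulgI/eqP; rewrite phi_eq1.
have wE : w = take j w ++ drop j w by rewrite cat_take_drop.
have Krest : \prod_(g <- take i w ++ drop j w) g \in K.
  move: (Kw); rewrite {1}wE -!phi_eq1 !big_cat !(snd (phi_morph K)) e.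
  by [].
have SE : word_seq Kw = word_seq Kmid * word_seq Krest.
  apply: word_seq_split; rewrite {1}wE eT perm_sym perm_catCA catA //.
case: (irr _ _ SE) => /(congr1 (fun S => size (seq_of S))).
  rewrite /= size_seq_mset size_mset0 => /size0nil/(congr1 (@size G)).
  by rewrite size_take size_drop /=; case: ifP; lia.
rewrite /= size_seq_mset size_mset0 => /size0nil/(congr1 (@size G)).
by rewrite size_cat size_drop /=; lia.
Qed.

(** For the normal subgroup [K] this says that [K] has index at most two. *)
Definition index_le2 := forall x y, x \notin K -> y \notin K -> x * y \in K.

(** Otherwise [x . y . (x * y)^-1] is an atom [U] of size three, and [U . U^-1]
has the lengths two and three. *)
Lemma half_factorial_index_le2 : half_factorial (prodMonoid K) -> index_le2.
Proof.
move=> hf x y nx ny; apply/negPn/negP => nxy.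
have Kw : \prod_(g <- [:: x; y; (x * y)^-1]) g \in K.
  by rewrite !big_cons big_nil mulg1 mulgA mulgV gpred1.
have AU : atom (word_seq Kw).
  by apply: small_word_atom => //=; rewrite gpredV nx ny nxy.
case: (lengths_mul_sinv AU) => [z|].
  rewrite /= -mset_gt0 mset_seqE -has_count has_pred1 !inE.
  by case/or3P => /eqP->; rewrite ?gpredV.
case: (hf (word_seq Kw * sinv (word_seq Kw))) => k -> <-.
by rewrite /= size_seq_mset.
Qed.

(** The number of copies of an atom [U] in a factorization is then the
multiplicity of a letter of [U] in the product, divided by its multiplicity in
[U]. *)
Lemma factorial_of_letters :
  (forall U V x, atom U -> atom V -> x \in seq_of U -> x \in seq_of V -> U = V) ->
  factorial_monoid (prodMonoid K).
Proof.
move=> shared; apply: (factorial_of_unique (@prodMonoid_reduced _ K)) => [S|].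
  exact: prodMonoid_atomic.
have countE (s : seq (prodMonoid K)) U x : (forall V, V \in s -> atom V) -> atom U ->
    x \in seq_of U -> seq_of (mprod s) x = (count_mem U s * seq_of U x)%N.
  move=> As AU xU; elim: s As => [|V s IH] As.
    by rewrite mprod_nil seq_of1 mset0E.
  rewrite mprod_cons seq_ofM msetE2 IH => [|V' V's]; last by apply: As; rewrite inE V's orbT.
  rewrite /= mulnDl; congr (_ + _)%N; case: eqP => [->|VU]; first by rewrite mul1n.
  apply/eqP; rewrite mul0n -leqn0 leqNgt mset_gt0; apply/negP => xV.
  by apply: VU; apply: (shared _ _ x) => //; apply: As; rewrite mem_head.
move=> S s t [As <-] [At e]; apply/allP => U; rewrite mem_cat => Ust /=.
have AU : atom U by case/orP: Ust => [/As|/At].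
have : U != 1 by apply/eqP/atom_neq1.
rewrite -size_seq_of_gt0; case E: (seq_of U : seq G) => [//|x w] _.
have xU : x \in seq_of U by rewrite -[_ \in _]/(x \in (seq_of U : seq G)) E mem_head.
have := congr1 (fun T => seq_of T x) e; rewrite /= !(countE _ U) // => /eqP.
by rewrite eqn_pmul2r ?mset_gt0 // eq_sym.
Qed.

(** An atom is a single letter of [K] or a power of the one element outside [K];
of two such powers, the smaller one divides the larger one within [B_K(G)]. *)
Lemma factorial_of_complement :
  (forall x y, x \notin K -> y \notin K -> x = y) -> factorial_monoid (prodMonoid K).
Proof.
move=> uniqK; apply: factorial_of_letters.
suff le U V x : (size (seq_of U) <= size (seq_of V))%N ->
    atom U -> atom V -> x \in seq_of U -> x \in seq_of V -> U = V.
  move=> U V x AU AV xU xV; case: (leqP (size (seq_of U)) (size (seq_of V))) => [l|/ltnW l].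
    exact: (le _ _ x).
  by apply/esym/(le _ _ x).
move=> UV AU AV xU xV; have [Kx|nKx] := boolP (x \in K).
  by apply: seq_of_inj; rewrite (atom_letter_in AU xU Kx) (atom_letter_in AV xV Kx).
have pow W : atom W -> x \in seq_of W -> exists Kn :
    \prod_(g <- nseq (size (seq_of W)) x) g \in K, W = word_seq Kn.
  move=> AW xW; have [w [Kw WE]] := seq_of_word W.
  have wE : w = nseq (size (seq_of W)) x.
    rewrite WE /= size_seq_mset; apply/all_pred1P/allP => z zw /=; apply/eqP.
    have zW : z \in seq_of W by rewrite WE -mset_gt0 mset_seqE -has_count has_pred1.
    apply: uniqK => //; apply/negP => Kz; move: xW; rewrite (atom_letter_in AW zW Kz).
    rewrite -mset_gt0 mset_seqE /= addn0 lt0b => /eqP zx.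
    by rewrite -zx Kz in nKx.
  move: Kw WE; rewrite {w}wE; set n := size _ => Kw WE; exists Kw.
  exact: WE.
have [Ku UE] := pow U AU xU; have [Kv VE] := pow V AV xV.
set n := size (seq_of U) in UV Ku UE; set m := size (seq_of V) in UV Kv VE.
have Kd : \prod_(g <- nseq (m - n) x) g \in K.
  have : \prod_(g <- nseq (n + (m - n)) x) g \in K by rewrite subnKC.
  by rewrite nseqD big_cat /= gpredMl.
have VUE : V = U * word_seq Kd.
  by rewrite [in LHS]VE UE; apply: word_seq_split; rewrite -nseqD subnKC.
case: ((atomP V).1 AV) => _ /(_ _ _ VUE)[U1|d1].
  by case: (atom_neq1 AU).
by rewrite VUE d1 mulg1.
Qed.

(** Compare [(x . x) (y . y)] with [(x . y) (x . y)]. *)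
Lemma factorial_complement : factorial_monoid (prodMonoid K) ->
  forall x y, x \notin K -> y \notin K -> x = y.
Proof.
move=> fK x y nx ny; have red := @prodMonoid_reduced _ K.
have K2 := half_factorial_index_le2 (factorial_half_factorial red fK).
have Kw a b : a \notin K -> b \notin K -> \prod_(g <- [:: a; b]) g \in K.
  by move=> na nb; rewrite big_cons big_seq1 K2.
pose pair a b (na : a \notin K) (nb : b \notin K) := word_seq (Kw a b na nb).
have Apair a b (na : a \notin K) (nb : b \notin K) : atom (pair a b na nb).
  by apply: small_word_atom => //=; rewrite na nb.
have e : perm_eq [:: pair x x nx nx; pair y y ny ny] [:: pair x y nx ny; pair x y nx ny].
  apply: (factorial_unique red fK (a := pair x x nx nx * pair y y ny ny)).
    exact: (factors_cat (factors1 (Apair _ _ _ _)) (factors1 (Apair _ _ _ _))).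
  have -> : pair x x nx nx * pair y y ny ny = pair x y nx ny * pair x y nx ny.
    apply: seq_of_inj; rewrite !seq_ofM /= -!seq_mset_cat; apply/eq_seq_msetP.
    by rewrite /= perm_cons (perm_catCA [:: x] [:: y]).
  exact: (factors_cat (factors1 (Apair _ _ _ _)) (factors1 (Apair _ _ _ _))).
have : pair x x nx nx \in [:: pair x y nx ny; pair x y nx ny] by rewrite -(perm_mem e) mem_head.
rewrite !inE orbb => /eqP/(congr1 (fun S => seq_of S y)).
rewrite /= !mset_seqE /= eqxx; case: eqP => // _; lia.
Qed.

End Atoms.

(** * Connectedness of the fibres *)

Section FibreChains.
Variables (G : groupType) (K : normalClosed G).
Implicit Types (x y g h : G) (A B : {mset G}%mset).
Implicit Types (S T U V W : prodMonoid K) (s t w : seq (prodMonoid K)).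
Local Open Scope mset_scope.
Local Open Scope group_scope.
Let redK := @prodMonoid_reduced G K.
Let redQ := @prodMonoid_reduced _ (triv_normal (quotGroup K)).
Let tr := @phi_seq_transfer G K.

(** Replacing a letter by another one of the same coset keeps the image, and thus
keeps atoms atoms. *)
Lemma replace_letter S g h : g \in seq_of S -> phi K g = phi K h ->
  exists2 S', phi_seq S' = phi_seq S & seq_of S' `+` seq_mset [:: g] = seq_of S `+` seq_mset [:: h].
Proof.
move=> gS gh; set B := seq_of S `\ g.
have SE : seq_of S = seq_mset [:: g] `+` B.
  rewrite -[LHS](msetB1K gS); congr (_ `+` _).
  by apply/msetP => x; rewrite msetnE mset_seqE /= addn0 eq_sym; case: eqP.
have e : map_mset (phi K) (seq_mset [:: h] `+` B) = map_mset (phi K) (seq_of S).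
  by rewrite SE !map_msetD !map_mset_seq /= gh.
have KA : seq_mset [:: h] `+` B \in product_in K.
  by rewrite -product_in_phi e product_in_phi; exact: seq_ofP.
exists (ProdSeq KA); first exact: val_inj.
by rewrite /= SE msetDAC [in RHS]msetDAC (msetDC (seq_mset [:: h])).
Qed.

(** After cancelling the common letters of [U] and [V], what remains on the two
sides still has the same image. *)
Lemma phi_seq_excess U V g : phi_seq U = phi_seq V -> g \in seq_of U `\` seq_of V ->
  exists2 h, h \in seq_of V `\` seq_of U & phi K g = phi K h.
Proof.
move=> /(congr1 (@seq_of _ _)) /= e gUV.
have split A B : A = A `&` B `+` (A `\` B) by apply/msetP => x; rewrite !msetE2; lia.
have e' : map_mset (phi K) (seq_of U `\` seq_of V) = map_mset (phi K) (seq_of V `\` seq_of U).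
  apply: (can_inj (msetDKB (map_mset (phi K) (seq_of U `&` seq_of V)))).
  by rewrite -map_msetD -split [in RHS]msetIC -map_msetD -split.
have : phi K g \in map_mset (phi K) (seq_of U `\` seq_of V).
  rewrite /map_mset -mset_gt0 mset_seqE -has_count has_pred1.
  by apply/mapP; exists g.
rewrite e' /map_mset -mset_gt0 mset_seqE -has_count has_pred1 => /mapP[h hVU gh].
by exists h.
Qed.

Lemma size_phi_seq S : size (seq_of (phi_seq S)) = size (seq_of S).
Proof. by rewrite /= size_seq_mset size_map. Qed.

(** The atoms of [s] are turned into those of [t] one after the other; [w] holds
those already settled.  To turn [U] into [V], exchange an excess letter [g] of [U]
with a missing letter [h] of the same coset.  As the total products agree, [h]
occurs in a later atom [W].  The exchange changes [U] and [W] only, and makes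
[U `\` V] smaller. *)
Lemma fibre_chain a (c : {mset assocClass (prodOneMonoid (quotGroup K))}) s t w :
  map (@phi_seq G K) s = map (@phi_seq G K) t ->
  factors a (w ++ s) -> factors a (w ++ t) ->
  fact_image (@phi_seq G K) (formal (w ++ t)) = c ->
  chained (factorizations a `&` [set y | fact_image (@phi_seq G K) y = c])%classic 2
    (formal (w ++ s)) (formal (w ++ t)).
Proof.
elim: t s w => [|V t IHt] [|U s] w //=; first by move=> *; exact: chained_refl.
move/eqP; rewrite eqseq_cons => /andP[/eqP UV /eqP st].
have [n] := ubnP (size (seq_of U `\` seq_of V)); elim: n U s UV st => // n IHn U s UV st Un.
move=> sa ta tc.
have [e|[g gUV]] := mset_0Vmem (seq_of U `\` seq_of V).
  have {e} UsV : seq_of U `<=` seq_of V by rewrite -msetB_eq0 e.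
  have UE : U = V.
    apply: seq_of_inj; rewrite -(msetBDKC UsV).
    suff -> : seq_of V `\` seq_of U = mset0 by rewrite msetD0.
    apply/eqP; rewrite -size_mset_eq0 -(eqn_add2l (size (seq_of U))) -size_msetD msetBDKC //.
    by rewrite addn0 -size_phi_seq -UV size_phi_seq.
  rewrite UE -!cat_rcons in sa ta tc *.
  exact: IHt.
have [h hVU gh] := phi_seq_excess UV gUV.
move: (gUV) (hVU); rewrite !in_msetB => gV hU.
have gU : g \in seq_of U by rewrite -mset_gt0 (leq_trans _ gV).
have [U' U'U U'E] := replace_letter gU gh.
have prodE : mprod (U :: s) = mprod (V :: t).
  by apply: (@ccmulI _ (mprod w)); rewrite -!mprod_cat sa.2 ta.2.
have : h \in seq_of (mprod s).
  move/(congr1 (fun S => seq_of S h)): prodE.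
  by rewrite !mprod_cons !seq_ofM !msetE2 -mset_gt0; move: hU; lia.
have hs : h \in seq_of (mprod s) -> exists2 W, W \in s & h \in seq_of W.
  elim: (s) => [|W r IH]; first by rewrite mprod_nil seq_of1 in_mset0.
  rewrite mprod_cons seq_ofM in_msetD => /orP[hW|/IH[W' Wr hW']].
    by exists W; rewrite ?mem_head.
  by exists W' => //; rewrite inE Wr orbT.
case/hs => W Ws hW; case/splitPr: Ws sa st prodE {hs} => s2 s3 sa st prodE.
have [W' W'W W'E] := replace_letter hW (esym gh).
have AU' : atom U'.
  apply/(atom_transfer redK redQ tr); rewrite U'U; apply/(atom_transfer redK redQ tr).
  by apply: sa.1; rewrite mem_cat mem_head orbT.
have AW' : atom W'.
  apply/(atom_transfer redK redQ tr); rewrite W'W; apply/(atom_transfer redK redQ tr).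
  by apply: sa.1; rewrite mem_cat inE mem_cat mem_head !orbT.
have UWE : U' * W' = U * W.
  apply/seq_of_inj/(can_inj (msetDKBC (seq_mset [:: g])))/(can_inj (msetDKBC (seq_mset [:: h]))).
  rewrite !seq_ofM; apply/msetP => x.
  move/msetP/(_ x): U'E; move/msetP/(_ x): W'E; rewrite !msetE2; lia.
have sa' : factors a (w ++ U' :: s2 ++ W' :: s3).
  split=> [X|].
    rewrite !(mem_cat, inE) => /orP[Xw|/predU1P[->//|/orP[X2|/predU1P[->//|X3]]]]; apply: sa.1.
    - by rewrite mem_cat Xw.
    - by rewrite !(mem_cat, inE) X2 !orbT.
    - by rewrite !(mem_cat, inE) X3 !orbT.
  rewrite -sa.2 !mprod_cat !mprod_cons !mprod_cat !mprod_cons; congr (_ * _).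
  have swap X Y : X * (mprod s2 * (Y * mprod s3)) = X * Y * (mprod s2 * mprod s3).
    by rewrite (mulgA (mprod s2)) (ccmulC _ Y) !mulgA.
  by rewrite !swap UWE.
have lt : (size (seq_of U' `\` seq_of V) < n)%N.
  rewrite -ltnS; apply: leq_trans Un.
  have <- : (seq_of U' `\` seq_of V) `+` seq_mset [:: g] = seq_of U `\` seq_of V.
    apply/msetP => x; move/msetP/(_ x): U'E; rewrite !msetE2 !mset_seqE /= !addn0.
    move: gV hU; case: (eqVneq g x) => [->|_]; case: (eqVneq h x) => [->|_]; rewrite /=; lia.
  by rewrite size_msetD size_seq_mset addn1.
have perm2 X Y : perm_eq (w ++ X :: s2 ++ Y :: s3) ((w ++ s2 ++ s3) ++ [:: X; Y]).
  by apply/permP => P; rewrite !count_cat /= !count_cat /=; lia.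
apply: (@chained_step _ _ _ _ (formal (w ++ U' :: s2 ++ W' :: s3))).
- split; first exact: factorizations_formal.
  by rewrite /= -tc !fact_image_formal // !map_cat /= !map_cat /= U'U W'W -st UV map_cat.
- by apply/(formal_dist redK); exists (w ++ s2 ++ s3), [:: U; W], [:: U'; W'].
by apply: IHn => //; rewrite ?U'U // -st !map_cat /= W'W.
Qed.

Lemma fibre_connected2 a : fiber_connected (@phi_seq G K) a 2.
Proof.
move=> z z' /(factorizationsP redK)[s sa ->] /(factorizationsP redK)[t ta ->].
rewrite !fact_image_formal // => e.
have /perm_map_lift[s' ss' s't] : perm_eq (map (@phi_seq G K) s) (map (@phi_seq G K) t).
  by apply/(formal_eqP redQ).
have -> : formal s = formal s' by apply/(formal_eqP redK).
apply: (fibre_chain (w := [::])) => //=; first exact: factors_perm sa.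
by rewrite fact_image_formal.
Qed.

End FibreChains.

(** * Small quotients and class semigroups *)

Section Cardinalities.
Variables (G : groupType) (K : normalClosed G).
Implicit Types (x y g h : G).
Local Open Scope card_scope.
Local Open Scope group_scope.

Lemma card_le_ord (T : Type) (A : set T) n (f : T -> nat) :
  {in A &, injective f} -> (forall t, A t -> f t < n)%N -> A #<= `I_n.
Proof.
move=> fI fn; rewrite -(card_le_eql (inj_card_eq fI)).
by apply: subset_card_le => _ [x Ax <-]; exact: fn.
Qed.

Lemma ord_card_le (T : Type) (A : set T) n : A #<= `I_n ->
  exists2 f : T -> nat, {in A &, injective f} & (forall t, A t -> f t < n)%N.
Proof.
move=> /pcard_leP[f]; exists f; first exact: inj.
by move=> t At; exact: (@funS _ _ _ _ f _ At).
Qed.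

(** If [x], [y] and [x * y] lie outside [K], then [1], [phi x] and [phi y^-1] are
pairwise distinct. *)
Lemma card_quot_le2 : [set: quotGroup K]%classic #<= `I_2 <-> index_le2 K.
Proof.
split=> [/ord_card_le[f fI f2] x y nx ny|K2].
  apply/negPn/negP => nxy.
  have [f1 fx fy] : [/\ f 1 < 2, f (phi K x) < 2 & f (phi K y^-1) < 2] by split; exact: f2.
  have inj q r : f q = f r -> q = r by apply: fI; rewrite inE.
  have n1 : f 1 <> f (phi K x) by move=> /inj/esym/eqP; rewrite phi_eq1 (negPf nx).
  have n2 : f 1 <> f (phi K y^-1) by move=> /inj/esym/eqP; rewrite phi_eq1 gpredV (negPf ny).
  have n3 : f (phi K x) <> f (phi K y^-1).
    move=> /inj/eqP; rewrite -(inj_eq (mulIg (phi K y))) -!(snd (phi_morph K)) mulVg.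
    by rewrite (fst (phi_morph K)) phi_eq1 (negPf nxy).
  lia.
pose f (q : quotGroup K) := nat_of_bool (q != 1).
apply: (@card_le_ord _ _ _ f) => [q r _ _|q _]; rewrite /f; last by case: eqP.
have [->|q1] := eqVneq q 1; have [->|r1] := eqVneq r 1 => // _.
rewrite -[q]phi_repr phi_eq1 in q1; rewrite -[r]phi_repr phi_eq1 in r1.
have := K2 (repr q) (repr r)^-1 q1; rewrite gpredV => /(_ r1).
rewrite -phi_eq1 (snd (phi_morph K)) phi_repr -(inj_eq (mulIg r)) mul1g -mulgA.
rewrite -{2}[r]phi_repr -(snd (phi_morph K)) mulVg (fst (phi_morph K)) mulg1.
by move/eqP.
Qed.

Lemma card_setC_le1 :
  [set x | x \notin K]%classic #<= `I_1 <-> (forall x y, x \notin K -> y \notin K -> x = y).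
Proof.
split=> [/ord_card_le[f fI f1] x y nx ny|uniqK].
  apply: fI; rewrite ?inE //; have := f1 _ nx; have := f1 _ ny; lia.
by apply: (@card_le_ord _ _ _ (fun _ => 0%N)) => // x y; rewrite !inE => nx ny _; exact: uniqK.
Qed.

Lemma index_le2_of_complement :
  (forall x y, x \notin K -> y \notin K -> x = y) -> index_le2 K.
Proof.
move=> uniqK x y nx ny; by rewrite (uniqK x y^-1) ?gpredV // mulVg gpred1.
Qed.

Lemma complement_triv : K =i triv_subgroup G -> index_le2 K ->
  forall x y, x \notin K -> y \notin K -> x = y.
Proof.
move=> K1 K2 x y nx ny; have := K2 x y^-1 nx; rewrite gpredV => /(_ ny).
by rewrite K1 inE -(inj_eq (mulIg y)) mulgVK mul1g => /eqP.
Qed.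

Lemma quot_index_le2 : index_le2 K -> forall q r : quotGroup K,
  q \notin triv_normal (quotGroup K) -> r \notin triv_normal (quotGroup K) -> q = r.
Proof.
move=> /card_quot_le2/ord_card_le[f fI f2] q r; rewrite !inE => q1 r1.
have inj q' r' : f q' = f r' -> q' = r' by apply: fI; rewrite inE.
apply: (inj q r); have := f2 1 I; have := f2 q I; have := f2 r I.
have : f q <> f 1 by move=> e; move: q1; rewrite (inj _ _ e) eqxx.
have : f r <> f 1 by move=> e; move: r1; rewrite (inj _ _ e) eqxx.
lia.
Qed.

(** If [g] is the only element outside [K], then [g * k = g] for all [k] in [K],
so [K] is trivial and [G] has the two elements [1] and [g]. *)
Lemma complement_iso :
  (forall x y, x \notin K -> y \notin K -> x = y) <->
  (K =i predT \/ (isomorphic G 'Z_2 /\ K =i triv_subgroup G)).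
Proof.
split=> [uniqK|[KT|[[f [f' fK f'K]] K1]] x y]; last 2 first.
- by rewrite KT.
- rewrite !K1 !inE => nx ny; apply: (can_inj fK).
  have f1 : f 1 = 0%R.
    by apply: (@addrI _ (f 1)); rewrite addr0 -[in RHS](mulg1 1) gmulfM.
  have nf z : z != 1 -> f z != 0%R by rewrite -f1 (inj_eq (can_inj fK)).
  move: (nf _ nx) (nf _ ny); case: (f x) => [[|[|m]] mi] //; case: (f y) => [[|[|k]] ki] // _ _.
  exact: val_inj.
have [[g ng]|noK] := pselect (exists g, g \notin K); last first.
  by left=> x; apply/negPn/negP => nx; apply: noK; exists x.
right; have K1 : K =i triv_subgroup G.
  move=> k; rewrite !inE; apply/idP/eqP => [Kk|->]; last exact: gpred1.
  by apply: (@mulgI _ g); rewrite mulg1; apply: uniqK; rewrite // gpredMr.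
split=> //; have K2 := index_le2_of_complement uniqK.
pose f x : 'Z_2 := if x \in K then 0%R else 1%R.
have fM : {morph f : x y / x * y >-> (x * y : 'Z_2)}.
  move=> x y; rewrite /f; have [Kx|nx] := boolP (x \in K).
    by rewrite gpredMl //; apply: esym; exact: add0r.
  have [Ky|ny] := boolP (y \in K).
    by rewrite gpredMr // (negPf nx); apply: esym; exact: addr0.
  by rewrite K2 //; exact: val_inj.
pose F : {multiplicative G -> 'Z_2} := HB.pack f (isMultiplicative.Build G 'Z_2 f fM).
exists F; exists (fun z : 'Z_2 => if z == 0%R then 1 else g) => [x|z] /=; rewrite /f.
  have [Kx|nx] := boolP (x \in K); last exact: uniqK.
  by move: Kx; rewrite K1 inE eqxx => /eqP.
case: eqP => [->|/eqP]; first by rewrite gpred1.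
by rewrite (negPf ng); case: z => [[|[|m]] mi] // _; exact: val_inj.
Qed.

End Cardinalities.

Section ClassSemigroups.
Variables (G : groupType) (K : normalClosed G).
Local Open Scope quotient_scope.
Local Open Scope group_scope.
Let Q := quotGroup K.
Let CK := classSemigroup (product_in K).
Let CQ := classSemigroup (product_in (triv_normal Q)).
Implicit Types (A B : {mset G}%mset).

(** The test sequences over [G/K] are exactly the images of those over [G]. *)
Lemma class_rel_phi A B :
  class_rel (product_in (triv_normal Q)) (map_mset (phi K) A) (map_mset (phi K) B) =
  class_rel (product_in K) A B.
Proof.
apply/asboolP/asboolP => e X.
  by rewrite -!(product_in_phi K) !map_msetD; exact: e.
have [Y <-] := map_mset_onto X; have := e Y.
by rewrite -!(product_in_phi K) !map_msetD.
Qed.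

Definition class_phi (c : CK) : CQ := \pi_CQ (map_mset (phi K) (repr c)).

Lemma class_phi_pi A : class_phi (\pi_CK A) = \pi_CQ (map_mset (phi K) A).
Proof.
apply/eqP; rewrite eqmodE /= class_rel_phi.
by rewrite -[class_rel _ _ _]/(class_equiv _ _ _) -eqmodE reprK.
Qed.

Lemma class_phiM : {morph class_phi : c d / c * d}.
Proof.
move=> c d; rewrite -[c]reprK -[d]reprK [X in class_phi X]class_mulE !class_phi_pi.
by rewrite [RHS]class_mulE map_msetD.
Qed.

HB.instance Definition _ := isMultiplicative.Build CK CQ class_phi class_phiM.

Lemma class_phi_iso : isomorphic CK CQ.
Proof.
exists class_phi.
pose lift (X : {mset Q}%mset) := seq_mset (map repr (X : seq _)).
have liftK X : map_mset (phi K) (lift X) = X.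
  rewrite map_mset_seq -map_comp map_id_in ?seq_mset_id // => q _; exact: phi_repr.
exists (fun d : CQ => \pi_CK (lift (repr d))) => [c|d].
  rewrite -[RHS]reprK; apply/eqP; rewrite eqmodE /= -class_rel_phi liftK.
  by rewrite -[class_rel _ _ _]/(class_equiv _ _ _) -eqmodE reprK.
by apply: (etrans (class_phi_pi _)); rewrite liftK reprK.
Qed.

End ClassSemigroups.

(** * Elasticities and catenary degrees *)

Section Bounds.
Variables (R : realType) (G : groupType) (K : normalClosed G).
Implicit Types (x y g h : G).
Implicit Types (S T U V W : prodMonoid K) (s t : seq (prodMonoid K)).
Local Open Scope group_scope.
Let redK := @prodMonoid_reduced G K.
Let B := prodMonoid K : ccMonoidType.

Lemma exists_atom : exists U, atom U.
Proof.
have K1 : \prod_(g <- [:: 1]) g \in K by rewrite big_seq1 gpred1.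
exists (word_seq K1); apply/atomP; split.
  by apply/eqP; rewrite -size_seq_of_gt0 /= size_seq_mset.
have s1 : size (seq_of (word_seq K1)) = 1%N by rewrite /= size_seq_mset.
move=> T U e; move: s1; rewrite e size_seq_ofM => s1.
case: (posnP (size (seq_of T))) => [/seq_of_size0|T0]; first by left.
case: (posnP (size (seq_of U))) => [/seq_of_size0|U0]; first by right.
lia.
Qed.

Lemma pair_atom g : g \notin K -> exists2 U : prodMonoid K, atom U & size (seq_of U) = 2%N.
Proof.
move=> ng; exists (word_seq (mem_inv_pair K g)); last by rewrite /= size_seq_mset.
by apply: small_word_atom => //=; rewrite gpredV ng.
Qed.

Lemma davenport_cases : davenport R K = +oo%E \/ exists d, [/\ davenport R K = d%:R%:E%E,
  exists2 U : prodMonoid K, atom U & size (seq_of U) = d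
  & forall U, atom U -> (size (seq_of U) <= d)%N].
Proof.
set A := [set size (seq_of S) | S in @atom B]%classic.
have [[b bA]|nb] := pselect (exists b, forall k, A k -> (k <= b)%N).
  have [U0 AU0] := exists_atom.
  have [d [[U AU Ud] dE dmax]] := nsup_attained R (ex_intro2 _ _ U0 AU0 erefl : A _) bA.
  right; exists d; split=> //; first by exists U.
  by move=> V AV; apply: dmax; exists V.
left; apply: nsup_unbounded => b; apply/notP => nk; apply: nb; exists b => k Ak.
by rewrite leqNgt; apply/negP => bk; apply: nk; exists k.
Qed.

Lemma half_nat (n : nat) : (n%:R%:E / 2%:E = (n%:R / 2)%:E :> \bar R)%E.
Proof. by rewrite inver pnatr_eq0 EFinM. Qed.

Lemma lengths_nonempty S : exists k, lengths S k.
Proof. by have [s sS] := prodMonoid_atomic S; exists (size s); apply/(lengthsP redK); exists s. Qed.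

Lemma lengths_bounded S k : lengths S k -> (k <= size (seq_of S))%N.
Proof.
move=> /(lengthsP redK)[s [As <-] <-].
elim: s As => // U s IH As; rewrite mprod_cons size_seq_ofM /= -add1n leq_add //.
  by rewrite size_seq_of_gt0; apply/eqP/atom_neq1/As; rewrite mem_head.
by apply: IH => V Vs; apply: As; rewrite inE Vs orbT.
Qed.

Lemma lengths_gt0 S k l : lengths S k -> lengths S l -> l != 0%N -> (0 < k)%N.
Proof.
move=> /(lengthsP redK)[s sS <-] /(lengthsP redK)[t tS <-]; rewrite lt0n; apply: contra.
move=> /eqP/size0nil s0; move: tS; rewrite -sS.2 s0 mprod_nil.
by move/(factors_nil)=> ->.
Qed.

Lemma lengths_extrema S : exists m M,
  [/\ lengths S m, lengths S M, ninf R (lengths S) = m%:R%:E%E, nsup R (lengths S) = M%:R%:E%E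
    & forall k, lengths S k -> (m <= k <= M)%N].
Proof.
have [k Sk] := lengths_nonempty S.
have [m [Sm mE mmin]] := ninf_attained R Sk.
have [M [SM ME Mmax]] := nsup_attained R Sk (@lengths_bounded S).
by exists m, M; split=> // l Sl; rewrite mmin // Mmax.
Qed.

Lemma rho_setE S : lengths S <> [set 0%N]%classic -> exists m M,
  [/\ lengths S m, lengths S M, (0 < m)%N, forall k, lengths S k -> (m <= k <= M)%N
    & rho_set R (lengths S) = (M%:R / m%:R)%:E%E].
Proof.
move=> nS; have [m [M [Sm SM mE ME mM]]] := lengths_extrema S.
have m0 : (0 < m)%N.
  have [k [Sk k0]] : exists k, lengths S k /\ k != 0%N.
    apply/not_existsP => k0; apply: nS; apply/seteqP; split=> k /=.
      by move=> Sk; apply/eqP/negPn/negP => kn; case: (k0 k).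
    have [l Sl] := lengths_nonempty S; move=> ->.
    have [l0|/eqP ln] := eqVneq l 0%N; first by rewrite -l0.
    by case: (k0 l); split=> //; apply/eqP.
  exact: lengths_gt0 Sm Sk k0.
exists m, M; split=> //; rewrite /rho_set asboolF // mE ME inver pnatr_eq0.
by rewrite eqn0Ngt m0 EFinM.
Qed.

Lemma atom_size_bound_ge2 g d :
  g \notin K -> (forall U, atom U -> (size (seq_of U) <= d)%N) -> (2 <= d)%N.
Proof. by move=> /pair_atom[U AU <-]; apply. Qed.

Lemma rho_k_le k : (0 < k)%N -> ~ (K =i predT) ->
  (rho_k R B k <= k%:R%:E * davenport R K / 2%:E)%E.
Proof.
move=> k0 nK; have [g ng] : exists g, g \notin K.
  by apply/not_existsP => gK; apply: nK => g; apply/negPn/negP; exact: gK.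
case: davenport_cases => [->|[d [-> _ dmax]]].
  rewrite gt0_muley ?lte_fin ?ltr0n // inver pnatr_eq0 /=.
  by rewrite gt0_mulye ?leey // lte_fin invr_gt0 ltr0n.
have d2 := atom_size_bound_ge2 ng dmax.
apply: nsup_le => l /(UsetP redK)[s [t [st As <- <-]]].
rewrite -EFinM -natrM half_nat lee_fin ler_pdivlMr ?ltr0n // -natrM ler_nat mulnC.
exact: (lengths_ratio d2 dmax (conj As erefl) st).
Qed.

Lemma rho_set_le S : ~ (K =i predT) -> (rho_set R (lengths S) <= davenport R K / 2%:E)%E.
Proof.
move=> nK; have [g ng] : exists g, g \notin K.
  by apply/not_existsP => gK; apply: nK => g; apply/negPn/negP; exact: gK.
case: davenport_cases => [->|[d [-> _ dmax]]].
  by rewrite inver pnatr_eq0 /= gt0_mulye ?leey // lte_fin invr_gt0 ltr0n.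
have d2 := atom_size_bound_ge2 ng dmax; rewrite half_nat.
have [S0|/rho_setE[m [M [Sm SM m0 _ ->]]]] := pselect (lengths S = [set 0%N]%classic).
  by rewrite /rho_set asboolT // lee_fin ler_pdivlMr ?ltr0n // mul1r ler_nat.
move: Sm SM => /(lengthsP redK)[s sS sm] /(lengthsP redK)[t tS tM].
rewrite lee_fin ler_pdivrMr ?ltr0n // mulrAC ler_pdivlMr ?ltr0n // -!natrM ler_nat.
have := lengths_ratio d2 dmax sS tS; rewrite sm tM; lia.
Qed.

Lemma elasticity_le : ~ (K =i predT) -> (elasticity R B <= davenport R K / 2%:E)%E.
Proof. by move=> nK; apply: ge_ereal_sup => _ [S _ <-]; exact: rho_set_le. Qed.

Lemma elasticity_half_factorial : half_factorial B ->
  elasticity R B = 1%E /\ accepted_elasticity R B.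
Proof.
move=> hf; have rho1 S : rho_set R (lengths S) = 1%E.
  have [S0|/rho_setE[m [M [Sm SM m0 _ ->]]]] := pselect (lengths S = [set 0%N]%classic).
    by rewrite /rho_set asboolT.
  have [k kE] := hf S; move: Sm SM m0; rewrite kE /= => -> -> m0.
  by rewrite divff // pnatr_eq0 -lt0n.
have E1 : elasticity R B = 1%E.
  apply/le_anti/andP; split; first by apply: ge_ereal_sup => _ [S _ <-]; rewrite rho1.
  by apply: ereal_sup_ubound; exists (1 : B).
by split=> //; exists (1 : B); rewrite rho1.
Qed.

(** With [U] an atom of maximal size [d], the lengths of [U . U^-1] contain [2]
and [d], so their ratio meets the general bound [d / 2]. *)
Lemma elasticity_finite_index : finite_set [set: quotGroup K]%classic -> ~ (K =i predT) ->
  [/\ elasticity R B = davenport R K / 2%:E, elasticity R B \is a fin_num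
    & accepted_elasticity R B]%E.
Proof.
move=> finQ nK; have [g ng] : exists g, g \notin K.
  by apply/not_existsP => gK; apply: nK => g; apply/negPn/negP; exact: gK.
have [q0 q0E] := (finite_seqP _).1 finQ.
have bound U : atom U -> (size (seq_of U) <= size q0)%N.
  apply: atom_size_le => q uq; apply: uniq_leq_size => // r _.
  have : [set: quotGroup K]%classic r by [].
  by rewrite q0E.
case: davenport_cases => [Dy|[d [dE [U AU Ud] dmax]]].
  have : (davenport R K <= (size q0)%:R%:E)%E.
    by apply: nsup_le => _ [U AU <-]; rewrite lee_nat bound.
  by rewrite Dy leye_eq.
have d2 := atom_size_bound_ge2 ng dmax.
have nKU x : x \in seq_of U -> x \notin K.
  move=> xU; apply/negP => Kx; move: Ud d2.
  by rewrite (atom_letter_in AU xU Kx) size_seq_mset /= => <-.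
have [L2 Ld] := lengths_mul_sinv AU nKU.
have le : (davenport R K / 2%:E <= rho_set R (lengths (U * sinv U)%g))%E.
  case: (@rho_setE (U * sinv U)) => [L0|m [M [_ _ m0 mM ->]]].
    by move: L2; rewrite L0.
  have /andP[m2 _] := mM _ L2; have /andP[_ dM] := mM _ Ld; rewrite Ud in dM.
  rewrite dE half_nat lee_fin ler_pdivrMr ?ltr0n // mulrAC ler_pdivlMr ?ltr0n //.
  by rewrite -!natrM ler_nat leq_mul.
have up : (rho_set R (lengths (U * sinv U)%g) <= elasticity R B)%E.
  by apply: ereal_sup_ubound; exists (U * sinv U).
have E : elasticity R B = (davenport R K / 2%:E)%E.
  by apply/le_anti; rewrite elasticity_le //= (le_trans le up).
split=> //; first by rewrite E dE half_nat.
by exists (U * sinv U); apply/le_anti; rewrite up andbT E le.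
Qed.

End Bounds.

Section CatenaryDegree.
Variables (R : realType) (G : groupType) (K : normalClosed G).
Let redK := @prodMonoid_reduced G K.

(** A reduced atomic monoid that is not half-factorial has an element with two
factorizations, and steps of size at most one do not move. *)
Lemma cat_deg_ge2 : ~ half_factorial (prodMonoid K) ->
  (2%:R%:E <= cat_deg R (prodMonoid K))%E.
Proof.
move=> nhf; have [a [s [t [sa ta nst]]]] : exists a s t,
    [/\ @factors (prodMonoid K) a s, factors a t & ~ perm_eq s t].
  apply/not_existsP => nex; apply: nhf; apply: (factorial_half_factorial redK).
  apply: (factorial_of_unique redK) => [S|S s t sS tS]; first exact: prodMonoid_atomic.
  by apply/negPn/negP => nst; apply: (nex S); exists s, t; split=> //; apply/negP.
apply: le_trans (_ : cat_deg_elt R a <= _)%E; last by apply: ereal_sup_ubound; exists a.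
apply: ninf_ge => N /= /(_ _ _ (factorizations_formal redK sa) (factorizations_formal redK ta)) ch.
rewrite lee_nat ltnNge; apply/negP => N1; apply: nst; apply/(formal_eqP redK).
suff eqch z z' : chained (factorizations a) N z z' -> factorizations a z -> z = z'.
  exact: eqch ch (factorizations_formal redK sa).
move: z z'; apply: chained_ind => // x y z ya xy _ IH xa; rewrite -(IH ya).
have [p pa xE] := (factorizationsP redK _ _).1 xa.
have [q qa yE] := (factorizationsP redK _ _).1 ya.
rewrite xE yE in xy *; apply/(formal_eqP redK); apply: (fact_dist_le1 pa qa).
by apply/(formal_dist redK)/(leq_trans xy N1).
Qed.

End CatenaryDegree.

Section DavenportConstant.
Variables (R : realType) (G : groupType) (K : normalClosed G).
Let redK := @prodMonoid_reduced G K.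
Let redQ := @prodMonoid_reduced _ (triv_normal (quotGroup K)).
Let tr := @phi_seq_transfer G K.

Lemma davenport_quot : davenport R K = davenport R (triv_normal (quotGroup K)).
Proof.
rewrite /davenport; congr (nsup R _); apply/seteqP; split=> _ [S AS <-].
  by exists (phi_seq S); [apply/(atom_transfer redK redQ tr) | exact: size_phi_seq].
have [T TS] := transfer_onto redQ tr S; rewrite -TS in AS *.
by exists T; [apply/(atom_transfer redK redQ tr) | rewrite size_phi_seq].
Qed.

End DavenportConstant.

(** * The theorem *)

Local Open Scope classical_set_scope.
Local Open Scope card_scope.
Local Open Scope ereal_scope.

Theorem theorem3p4 (R : realType) (G : groupType) (K : normalClosed G) :
  let Q : groupType := quotGroup K in
  let BK : ccMonoidType := prodMonoid K in
  let BQ : ccMonoidType := prodOneMonoid Q in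
  let DK : \bar R := davenport R K in
  let DQ : \bar R := davenport R (triv_normal Q) in
  let item3a := half_factorial BK in
  let item3b := [set: Q] #<= `I_2 in
  let item3c := factorial_monoid BQ in
  let item3d := half_factorial BQ in
  let item4a := factorial_monoid BK in
  let item4b := [set: Q] #<= `I_2 /\ [set x | x \notin K] #<= `I_1 in
  let item4c :=
    K =i predT \/ (isomorphic G 'Z_2 /\ K =i triv_subgroup G) in
  (* Item 1. The bounds by D/2 fail for K = G (there D = 1 and rho_k = k). *)
  [/\ transfer_hom (@phi_seq G K),
      system_of_lengths BK = system_of_lengths BQ,
      (forall k, (0 < k)%N -> Uset BK k = Uset BQ k /\ nat_interval (Uset BK k))
    & [/\ DK = DQ,
          (forall k, (0 < k)%N ->
             rho_k R BK k = rho_k R BQ k /\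
             (~ (K =i predT) ->
                rho_k R BQ k <= k%:R%:E * DQ / 2%:E /\
                k%:R%:E * DQ / 2%:E = k%:R%:E * DK / 2%:E)),
          elasticity R BK = elasticity R BQ /\
          (~ (K =i predT) ->
             elasticity R BQ <= DQ / 2%:E /\ DQ / 2%:E = DK / 2%:E)
        & finite_set [set: Q] ->
          [/\ (~ (K =i predT) -> elasticity R BK = DK / 2%:E),
              elasticity R BK \is a fin_num
            & accepted_elasticity R BK]]] /\
  (* Item 2 *)
  isomorphic (classSemigroup (product_in K))
             (classSemigroup (product_in (triv_normal Q))) /\
  (* Item 3 *)
  [<-> item3a; item3b; item3c; item3d] /\
  (* Item 4 *)
  [<-> item4a; item4b; item4c] /\
  (K =i triv_subgroup G ->
     (item3b <-> item4b) /\
     [<-> item3a; item3b; item3c; item3d; item4a; item4b; item4c]) /\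
  (* Item 5 *)
  (cat_deg_fib R (@phi_seq G K) <= 2%:E /\
   (`I_3 #<= [set: Q] -> cat_deg R BK = cat_deg R BQ)).
Proof.
move=> Q BK BQ DK DQ item3a item3b item3c item3d item4a item4b item4c.
have redK : reduced BK := @prodMonoid_reduced G K.
have redQ : reduced BQ := @prodMonoid_reduced _ (triv_normal Q).
have tr := @phi_seq_transfer G K.
have DE : DK = DQ := davenport_quot R K.
have UE k : Uset BK k = Uset BQ k := Uset_transfer redK redQ tr k.
have elE : elasticity R BK = elasticity R BQ := elasticity_transfer redK redQ tr R.
have h3ab : item3a -> item3b by move=> hf; apply/card_quot_le2/half_factorial_index_le2.
have h3bc : item3b -> item3c.
  by move=> /card_quot_le2 K2; apply/factorial_of_complement/quot_index_le2.
have h3cd : item3c -> item3d := factorial_half_factorial redQ.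
have h3da : item3d -> item3a := half_factorial_transfer redK redQ tr.
have h4ab : item4a -> item4b.
  move=> f4; have uniqK := factorial_complement f4; split; last exact/card_setC_le1.
  exact/card_quot_le2/index_le2_of_complement.
have h4bc : item4b -> item4c by move=> [_ /card_setC_le1/complement_iso].
have h4ca : item4c -> item4a by move=> /complement_iso/factorial_of_complement.
split; last split; last split; last split; last split; last split.
- split=> //; first exact: (system_of_lengths_transfer redK redQ tr).
    by move=> k k0; split=> //; exact: Uset_interval.
  split=> //.
  + move=> k k0; split=> [|nK]; first by rewrite /rho_k UE.
    by rewrite -DE; split=> //; rewrite /rho_k -UE; exact: rho_k_le.
  + by split=> // nK; rewrite -elE -DE; split=> //; exact: elasticity_le.
  move=> finQ; have [KT|nK] := pselect (K =i predT).
    have hf : half_factorial BK.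
      by apply/h3da/h3cd/h3bc/card_quot_le2 => x y; rewrite KT.
    have [E1 acc] := elasticity_half_factorial R hf.
    by split=> //; rewrite E1.
  by have [EE fin acc] := elasticity_finite_index R finQ nK; split.
- exact: class_phi_iso.
- by tfae.
- by tfae.
- move=> K1; have h34 : item3b -> item4b.
    move=> b3; split=> //; apply/card_setC_le1/complement_triv => //.
    exact/card_quot_le2.
  split; first by split=> [/h34|[]].
  have h3d4a : item3d -> item4a by move=> d3; exact: (h4ca (h4bc (h34 (h3ab (h3da d3))))).
  have h4c3a : item4c -> item3a by move=> /h4ca/h4ab[b3 _]; exact: (h3da (h3cd (h3bc b3))).
  by tfae.
- exact: (cat_deg_fib_le R (@fibre_connected2 G K)).
move=> Q3; apply: (cat_deg_transfer redK redQ tr (@fibre_connected2 G K)).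
apply: cat_deg_ge2 => hf; have b3 : item3b := h3ab (h3da hf).
by have := card_le_trans Q3 b3; rewrite card_le_II.
Qed.
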